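(* Assume that (i) the cost sequence $(c_i)_{i\ge 1}$ is nonnegative and nondecreasing, and (ii) $\sum_{i=1}^\infty c_i q^i<\infty$. Then the discounted single-user model described in the context is threshold-indexable, with Whittle index given by the marginal productivity (MP) index $m_{(1,i)}$, i.e., $\nu^*_{(1,i)}=m_{(1,i)}$ for every $i\ge 1$.
   Context: Single-user model. Fix $\lambda\in(0,1]$ (packet arrival probability), $\mu\in(0,1]$ (transmission success probability) and $\beta\in(0,1)$ (discount factor); put $p=\lambda\mu$, $q=1-p$, $\mathbb N=\{1,2,\dots\}$. A controlled Markov chain $Y(t)=(B(t),X(t))$, $t=0,1,\dots$, lives on $\{0,1\}\times\mathbb N$; $X(t)$ is the Age of Information (AoI), and $B(t)=1$ iff a packet has just been generated. Actions are $A(t)\in\{0,1\}$ ($1$ = attempt transmission, $0$ = do not). In states $(0,i)$ only action $0$ is available; in states $(1,i)$ both are. Transitions: if $Y(t)=(b,i)$ and $A(t)=0$, then $X(t+1)=i+1$; if $Y(t)=(1,i)$ and $A(t)=1$, then $X(t+1)=1$ with probability $\mu$ and $X(t+1)=i+1$ with probability $1-\mu$. In all cases $B(t+1)$ equals $1$ with probability $\lambda$ and $0$ with probability $1-\lambda$, independently of $X(t+1)$. The cost in a slot with AoI $i$ is $c_i$. Let $\Pi$ be the class of stationary policies (the action choice is based only on the current state). For a policy $\pi$ and initial state $(b,i)$ put $F_{(b,i)}^\pi=\mathbb E_{(b,i)}^\pi[\sum_{t\ge0}c_{X(t)}\beta^t]$ (cost metric) and $G_{(b,i)}^\pi=\mathbb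 E_{(b,i)}^\pi[\sum_{t\ge0}A(t)\beta^t]$ (work metric). For a transmission attempt charge $\nu\in\mathbb R$, the single-user subproblem is to minimize $F_{(b,i)}^\pi+\nu G_{(b,i)}^\pi$ over $\pi\in\Pi$. Threshold policies. For a nonnegative integer $k\ge0$, the $k$-threshold policy ($k$-policy) attempts to transmit a packet in state $(1,j)$ if and only if $j>k$. MP index. For an integer $k\ge0$ and $a\in\{0,1\}$ let $\langle a,k\rangle$ be the policy that takes action $a$ at $t=0$ and follows the $k$-policy from $t=1$ onward. For $i\ge1$ put $f_{(1,i)}^k=F_{(1,i)}^{\langle0,k\rangle}-F_{(1,i)}^{\langle1,k\rangle}$ (marginal cost metric), $g_{(1,i)}^k=G_{(1,i)}^{\langle1,k\rangle}-G_{(1,i)}^{\langle0,k\rangle}$ (marginal work metric, which is positive), and $m_{(1,i)}=f_{(1,i)}^i/g_{(1,i)}^i$. Indexability. The model is indexable if for each AoI $j\in\mathbb N$ there exists a critical transmission attempt charge $\nu^*_{(1,j)}$, called the Whittle index, which characterizes the optimal policies for the subproblem under any $\nu\in\mathbb R$ as follows: in state $(1,j)$ it is optimal, for any initial state $(b,i)$, to attempt to transmit if and only if $\nu^*_{(1,j)}\ge\nu$, and it is optimal not to attempt to transmit if and only if $\nu^*_{(1,j)}\le\nu$. Threshold-indexability. The model is threshold-indexable if it is indexable and, moreover, threshold policies are optimal for the subproblem for any $\nu\in\mathbb R$.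
   Formalization: Threshold policies here also include the infinite threshold (never transmit): with only finite k, threshold optimality for every charge fails, e.g. for zero costs and a positive charge, where never transmitting is the only optimal threshold policy. *)

(* Defs.v *)
From HB Require Import structures.
From mathcomp Require Import all_boot all_order all_algebra.
From mathcomp Require Import all_classical all_reals all_analysis.
Set Implicit Arguments.
Unset Strict Implicit.
Unset Printing Implicit Defensive.
Import Order.TTheory GRing.Theory Num.Theory.
Local Open Scope classical_set_scope.
Local Open Scope ring_scope.

(* A state (b, i) is a packet-generation flag b and an Age of Information i.
   The AoI ranges over the positive integers: every quantifier over AoI values
   or initial states below carries the side condition 0 < i. *)
Definition state : Type := (bool * nat)%type.

(* r i is the probability of attempting to transmit in state (1, i); no rule is
   needed for the states (0, i), where only action 0 is available. *)
Definition rule (R : realType) : Type := nat -> {i01 R}.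

(* Time-dependent decision rules are needed for the policies <a, k>, which are
   not stationary. *)
Definition policy (R : realType) : Type := nat -> rule R.

Definition stationary (R : realType) (r : rule R) : policy R := fun=> r.

Definition pure (R : realType) (a : bool) : {i01 R} :=
  if a then 1%:i01 else 0%:i01.

Definition action_prob (R : realType) (r : rule R) (y : state) (a : bool) : R :=
  let x := if y.1 then (r y.2)%:num else 0 in if a then x else 1 - x.

Definition trans_prob (R : realType) (lambda mu : R) (y : state) (a : bool)
    (y' : state) : R :=
  (if y'.1 then lambda else 1 - lambda) *
  (if a then mu * (y'.2 == 1%N)%:R + (1 - mu) * (y'.2 == y.2.+1)%:R
   else (y'.2 == y.2.+1)%:R).

(* A realization of the controlled chain under policy pi from state y0, on an
   arbitrary probability space; the law of the process (B, X, A) is fixed by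
   its finite-dimensional distributions. For lambda and mu in [0, 1] one always
   exists, e.g. driven by a single uniform random variable on [0, 1[. *)
Record controlled_chain (R : realType) (lambda mu : R) (pi : policy R)
    (y0 : state) := ControlledChain {
  chain_disp : measure_display ;
  outcome : measurableType chain_disp ;
  chain_prob : probability outcome R ;
  flag : nat -> outcome -> bool ;
  aoi : nat -> outcome -> nat ;
  action : nat -> outcome -> bool ;
  measurable_flag : forall t, measurable_fun [set: outcome] (flag t) ;
  measurable_aoi : forall t, measurable_fun [set: outcome] (aoi t) ;
  measurable_action : forall t, measurable_fun [set: outcome] (action t) ;
  chain_law : forall (n : nat) (y : nat -> state) (a : nat -> bool),
    chain_prob [set w | forall t, (t <= n)%N ->
      (flag t w, aoi t w) = y t /\ action t w = a t] =
    ((y 0%N == y0)%:R * (\prod_(t < n.+1) action_prob (pi t) (y t) (a t)) *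
     \prod_(t < n) trans_prob lambda mu (y t) (a t) (y t.+1))%:E }.

Arguments outcome {R lambda mu pi y0} _.
Arguments chain_prob {R lambda mu pi y0} _.
Arguments flag {R lambda mu pi y0} _ _ _.
Arguments aoi {R lambda mu pi y0} _ _ _.
Arguments action {R lambda mu pi y0} _ _ _.

(* One realization for each policy and initial state; the metrics below depend
   on it only through the law of the process. *)
Definition chain_family (R : realType) (lambda mu : R) : Type :=
  forall (pi : policy R) (y : state), controlled_chain lambda mu pi y.

(* The metrics take values in \bar R because the cost metric of a policy that
   seldom transmits can be +oo. *)
Definition cost_metric (R : realType) (lambda mu beta : R) (c : nat -> R)
    (M : chain_family lambda mu) (pi : policy R) (y : state) : \bar R :=
  (\int[chain_prob (M pi y)]_w
     \sum_(0 <= t <oo) (c (aoi (M pi y) t w) * beta ^+ t)%:E)%E.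

Definition work_metric (R : realType) (lambda mu beta : R)
    (M : chain_family lambda mu) (pi : policy R) (y : state) : \bar R :=
  (\int[chain_prob (M pi y)]_w
     \sum_(0 <= t <oo) ((action (M pi y) t w)%:R * beta ^+ t)%:E)%E.

Definition objective (R : realType) (lambda mu beta : R) (c : nat -> R)
    (M : chain_family lambda mu) (nu : R) (pi : policy R) (y : state) : \bar R :=
  (cost_metric beta c M pi y + nu%:E * work_metric beta M pi y)%E.

Definition optimal (R : realType) (lambda mu beta : R) (c : nat -> R)
    (M : chain_family lambda mu) (nu : R) (r : rule R) : Prop :=
  forall y : state, (0 < y.2)%N -> forall r' : rule R,
    (objective beta c M nu (stationary r) y <=
     objective beta c M nu (stationary r') y)%E.

Definition optimal_action (R : realType) (lambda mu beta : R) (c : nat -> R)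
    (M : chain_family lambda mu) (nu : R) (j : nat) (a : bool) : Prop :=
  exists2 r : rule R, optimal beta c M nu r & r j = pure R a.

Definition is_whittle_index (R : realType) (lambda mu beta : R) (c : nat -> R)
    (M : chain_family lambda mu) (nustar : nat -> R) : Prop :=
  forall j : nat, (0 < j)%N -> forall nu : R,
    (optimal_action beta c M nu j true <-> nu <= nustar j) /\
    (optimal_action beta c M nu j false <-> nustar j <= nu).

Definition indexable (R : realType) (lambda mu beta : R) (c : nat -> R)
    (M : chain_family lambda mu) : Prop :=
  exists nustar : nat -> R, is_whittle_index beta c M nustar.

(* None is the infinite threshold (never transmit). It cannot be dispensed with:
   for c = 0 and nu > 0 it is the only optimal threshold policy. *)
Definition threshold (R : realType) (k : option nat) : rule R :=
  fun j => pure R (if k is Some k' then (k' < j)%N else false).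

Definition threshold_indexable (R : realType) (lambda mu beta : R)
    (c : nat -> R) (M : chain_family lambda mu) : Prop :=
  indexable beta c M /\
  forall nu : R, exists k : option nat, optimal beta c M nu (threshold R k).

(* The policy <a, k>. *)
Definition deviation (R : realType) (a : bool) (k : nat) : policy R :=
  fun t => if t is 0 then fun=> pure R a else threshold R (Some k).

Definition marginal_cost (R : realType) (lambda mu beta : R) (c : nat -> R)
    (M : chain_family lambda mu) (k i : nat) : \bar R :=
  (cost_metric beta c M (deviation R false k) (true, i) -
   cost_metric beta c M (deviation R true k) (true, i))%E.

Definition marginal_work (R : realType) (lambda mu beta : R)
    (M : chain_family lambda mu) (k i : nat) : \bar R :=
  (work_metric beta M (deviation R true k) (true, i) -
   work_metric beta M (deviation R false k) (true, i))%E.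

Definition mp_index (R : realType) (lambda mu beta : R) (c : nat -> R)
    (M : chain_family lambda mu) (i : nat) : \bar R :=
  (marginal_cost beta c M i i / marginal_work beta M i i)%E.

(* Main.v *)
(* Averaging over the flag turns the dynamic programming equation into one on
   ages only, W i = c i + beta W (i+1) + lambda min (0, phi i), where
   phi i = nu - beta mu (W (i+1) - W 1) is the net charge of an attempt at
   age i.  Value iteration started below every policy value increases to a
   solution W; since costs are nonnegative, W bounds all policies from below
   without any transversality condition, and the policies attaining it are those
   that attempt where phi < 0 and abstain where phi > 0.  As c is nondecreasing
   so is W, hence phi is nonincreasing in the age and some threshold policy is
   optimal.

   In the charge nu, the increments of W solve a linear renewal-type equation
   which bounds the slope of phi below by (1 - beta) / (1 - beta q) > 0; so phi
   vanishes at age i for exactly one charge, the Whittle index.  At that charge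
   the i-policy is optimal and both actions are equally good in state (1, i), so
   F + nu G takes the same value on <0, i> and <1, i>: the charge is the
   marginal cost divided by the marginal work. *)
Require Import Defs.
From HB Require Import structures.
From mathcomp Require Import all_boot all_order all_algebra.
From mathcomp Require Import all_classical all_reals all_analysis.
From mathcomp Require Import measurable_realfun.
From mathcomp Require Import ring lra.
Set Implicit Arguments.
Unset Strict Implicit.
Unset Printing Implicit Defensive.
Import Order.TTheory GRing.Theory Num.Theory.
Import numFieldNormedType.Exports.
Local Open Scope classical_set_scope.
Local Open Scope ring_scope.

(** * The law of the controlled chain *)

Section Expectation.
Context {R : realType}.
Variables lambda mu : R.

Definition flag_mean (u : state -> R) (i : nat) : R :=
  lambda * u (true, i) + (1 - lambda) * u (false, i).

Definition next_mean (a : bool) (u : state -> R) (i : nat) : R :=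
  if a then mu * flag_mean u 1 + (1 - mu) * flag_mean u i.+1
  else flag_mean u i.+1.

Definition action_mean (r : rule R) (y : state) (f : bool -> R) : R :=
  action_prob r y true * f true + action_prob r y false * f false.

(** Expectation of [h] at slot [n], by conditioning on the first slot. The policy is shifted in time
    along the recursion because [deviation] is not stationary. *)
Fixpoint mean (h : state -> bool -> R) (n : nat) (pi : policy R)
    (y : state) : R :=
  action_mean (pi 0%N) y (fun a =>
    if n is n'.+1 then next_mean a (mean h n' (fun t => pi t.+1)) y.2
    else h y a).

(** The same expectation once the first action is known; a [trajectory] event fixes its last action
    as well as its last state. *)
Definition mean_after (h : state -> bool -> R) (n : nat) (pi : policy R)
    (y : state) (a : bool) : R :=
  if n is n'.+1 then next_mean a (mean h n' (fun t => pi t.+1)) y.2 else h y a.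

Lemma meanE h n pi y :
  mean h n pi y = action_mean (pi 0%N) y (mean_after h n pi y).
Proof. by case: n. Qed.

Definition trajectory { pi y0} (C : controlled_chain lambda mu pi y0) (n : nat)
    (y : nat -> state) (a : nat -> bool) : set (outcome C) :=
  [set w | forall t, (t <= n)%N ->
     (flag C t w, aoi C t w) = y t /\ action C t w = a t].

Arguments trajectory { pi y0} C n y a.

Lemma measurable_trajectory pi y0 (C : controlled_chain lambda mu pi y0) n y a :
  measurable (trajectory C n y a).
Proof.
rewrite (_ : trajectory C n y a = \bigcap_(t in `I_n.+1)
  (flag C t @^-1` [set (y t).1] `&` aoi C t @^-1` [set (y t).2] `&`
   action C t @^-1` [set a t])).
  apply: bigcap_measurable => [|t _]; first by exists 0%N.
  apply: measurableI; first apply: measurableI.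
  - by rewrite -[X in measurable X]setTI; exact: (measurable_flag (c := C) t).
  - by rewrite -[X in measurable X]setTI; exact: (measurable_aoi (c := C) t).
  - by rewrite -[X in measurable X]setTI; exact: (measurable_action (c := C) t).
apply/seteqP; split=> w /= H t.
  by move=> /H[e1 e2]; rewrite /preimage /= -e1 e2.
move=> tn; have [[h1 h2] h3] := H t tn; split=> //.
by rewrite h1 h2; case: (y t).
Qed.

Lemma measurable_chain_fun pi y0 (C : controlled_chain lambda mu pi y0)
    (h : state -> bool -> R) t (D : set (outcome C)) :
  measurable_fun D (fun w => (h (flag C t w, aoi C t w) (action C t w))%:E :
    \bar R).
Proof.
apply: (@measurable_funS _ _ _ _ setT) => //.
have mX b a : measurable_fun setT (fun w => (h (b, aoi C t w) a)%:E : \bar R).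
  by apply: (@measurableT_comp _ _ _ _ _ _ (fun i : nat =>
    (h (b, i) a)%:E : \bar R)) => //;
     exact: measurable_aoi.
rewrite (_ : (fun w => _) = (fun w =>
   if flag C t w then
     if action C t w then (h (true, aoi C t w) true)%:E
     else (h (true, aoi C t w) false)%:E
   else if action C t w then (h (false, aoi C t w) true)%:E
     else (h (false, aoi C t w) false)%:E)); last first.
  by apply/funext => w; case: (flag C t w); case: (action C t w).
apply: measurable_fun_ifT; first exact: measurable_flag.
  by apply: measurable_fun_ifT => //; exact: measurable_action.
by apply: measurable_fun_ifT => //; exact: measurable_action.
Qed.

Definition update {T} (f : nat -> T) (n : nat) (x : T) : nat -> T :=
  fun t => if t == n then x else f t.

(* For [i > 0] these four states are distinct and carry all transitions. *)
Definition successors (i : nat) : seq (state * bool) :=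
  [seq (s, a) | s <- [:: (true, 1%N); (false, 1%N); (true, i.+1); (false, i.+1)],
                a <- [:: true; false]].

Lemma prob_trajectoryS pi y0 (C : controlled_chain lambda mu pi y0) n y a s b :
  chain_prob C (trajectory C n.+1 (update y n.+1 s) (update a n.+1 b)) =
  (chain_prob C (trajectory C n y a) *
   (trans_prob lambda mu (y n) (a n) s * action_prob (pi n.+1) s b)%:E)%E.
Proof.
rewrite !chain_law -EFinM; congr (_%:E).
have upd_lt T (f : nat -> T) x t : (t < n.+1)%N -> update f n.+1 x t = f t.
  by rewrite /update; case: eqP => // ->; rewrite ltnn.
have upd_n T (f : nat -> T) x : update f n.+1 x n.+1 = x.
  by rewrite /update eqxx.
rewrite big_ord_recr [X in _ * X = _]big_ord_recr /= !upd_n !upd_lt//.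
under eq_bigr => t _ do rewrite !upd_lt//.
under [X in _ * (X * _) = _]eq_bigr => t _.
  rewrite (upd_lt _ y) ?ltnS 1?ltnW//.
  rewrite (upd_lt _ a) ?ltnS 1?ltnW//.
  rewrite (upd_lt _ y) ?ltnS//.
  over.
ring.
Qed.

(** Induction on [m]: the event is split by the state and action of the next slot, and each piece is
    again a trajectory event, one slot longer and ending at a positive age. *)
Lemma integral_trajectory (h : state -> bool -> R)
    (h_ge0 : forall y a, 0 <= h y a) pi y0
    (C : controlled_chain lambda mu pi y0) m : forall n y a, (0 < (y n).2)%N ->
  (\int[chain_prob C]_(w in trajectory C n y a)
     (h (flag C (n + m) w, aoi C (n + m) w) (action C (n + m) w))%:E =
   chain_prob C (trajectory C n y a) *
   (mean_after h m (fun t => pi (n + t)%N) (y n) (a n))%:E)%E.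
Proof.
elim: m => [|m IH] n y a yn.
  rewrite (eq_integral (cst (h (y n) (a n))%:E)); last first.
    by move=> w /set_mem /(_ n (leqnn n)) [h1 h2]; rewrite addn0 h1 h2.
  by rewrite integral_cst; [exact: muleC|exact: measurable_trajectory].
pose E := trajectory C n y a.
pose F (s : state * bool) :=
  trajectory C n.+1 (update y n.+1 s.1) (update a n.+1 s.2).
pose D := \big[setU/set0]_(s <- successors (y n).2) F s.
have mE : measurable E by exact: measurable_trajectory.
have mF s : measurable (F s) by exact: measurable_trajectory.
have mD : measurable D by exact: bigsetU_measurable.
have DE : D `<=` E.
  rewrite /D -bigcup_seq => w [s _] /= Fw t tn.
  have := Fw t (leqW tn); rewrite /update.
  by case: eqP => // e; rewrite e ltnn in tn.
have uS : uniq (successors (y n).2).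
  case: (y n).2 yn => [//|i] _.
  by rewrite /successors /= !inE !xpair_eqE /= ?eqSS ?andbF ?andbT ?orbF.
have tF : trivIset [set` successors (y n).2] F.
  apply/trivIsetP => -[s b] [s' b'] _ _ ne.
  apply/seteqP; split=> // w /= [/(_ n.+1 (leqnn _)) + /(_ n.+1 (leqnn _))].
  rewrite /update eqxx => -[h1 h2] [h3 h4]; move/eqP: ne; apply.
  by move: h1 h2 h3 h4 => /= <- <- <- <-.
have intD (f : outcome C -> \bar R) : measurable_fun D f ->
    (forall x, D x -> 0 <= f x)%E ->
    (\int[chain_prob C]_(w in D) f w =
     \sum_(s <- successors (y n).2) \int[chain_prob C]_(w in F s) f w)%E.
  by move=> mf f0; rewrite ge0_integral_bigsetU.
have PF s : chain_prob C (F s) = (chain_prob C E *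
   (trans_prob lambda mu (y n) (a n) s.1 * action_prob (pi n.+1) s.1 s.2)%:E)%E.
  exact: prob_trajectoryS.
have PEfin : chain_prob C E \is a fin_num by exact: fin_num_measure.
set p : R := fine (chain_prob C E).
have PE : chain_prob C E = p%:E by rewrite fineK.
(* The transition and action probabilities over [successors] sum to 1, so the pieces exhaust the
   event up to a null set, which the integral ignores. *)
have PD : chain_prob C D = chain_prob C E.
  rewrite -[LHS]mul1e -integral_cst// intD//.
  rewrite (eq_bigr (fun s => (p * (trans_prob lambda mu (y n) (a n) s.1 *
      action_prob (pi n.+1) s.1 s.2))%:E)); last first.
    by move=> s _; rewrite integral_cst// mul1e [LHS]PF PE -EFinM.
  rewrite PE sumEFin; congr (_%:E).
  rewrite /successors /= !big_cons big_nil /trans_prob /action_prob /=.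
  rewrite !eqxx.
  have -> : (((y n).2.+1 == 1%N) = false) by case: (y n).2 yn.
  have -> : ((1%N == (y n).2.+1) = false) by case: (y n).2 yn.
  by case: (a n) => /=; ring.
rewrite (@ge0_negligible_integral _ _ _ _ _ (E `\` D)) //; last 4 first.
- exact: measurableD.
- exact: measurable_chain_fun.
- by move=> x _; rewrite lee_fin.
- rewrite measureD//; last by rewrite -ge0_fin_numE.
  by rewrite (setIidr DE) [X in (_ - X)%E]PD subee.
rewrite setDD (setIidr DE) intD//; last 2 first.
- exact: measurable_chain_fun.
- by move=> x _; rewrite lee_fin.
rewrite (eq_big_seq (fun s => (p * (trans_prob lambda mu (y n) (a n) s.1 *
   action_prob (pi n.+1) s.1 s.2) *
   mean_after h m (fun t => pi (n.+1 + t)%N) s.1 s.2)%:E)%E); last first.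
  move=> s sS; rewrite -addSnnS IH; last first.
    rewrite /update eqxx; move: sS.
    rewrite !inE; do !(case/orP => [/eqP-> //|]); by move/eqP->.
  by rewrite [X in (X * _)%E]PF PE -!EFinM /update !eqxx.
rewrite sumEFin [chain_prob C _]PE -EFinM; congr (_%:E).
rewrite [mean_after h m.+1]/mean_after.
have mE' s : mean h m (fun t => pi (n + t.+1)%N) s =
  action_mean (pi n.+1) s (mean_after h m (fun t => pi (n.+1 + t)%N) s).
  rewrite meanE addn1; congr (action_mean _ _ (mean_after _ _ _ _)).
  by apply/funext => t; rewrite addnS.
rewrite /next_mean /flag_mean !mE' /action_mean.
rewrite /successors /= !big_cons big_nil /trans_prob /=.
rewrite !eqxx.
have -> : (((y n).2.+1 == 1%N) = false) by case: (y n).2 yn.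
have -> : ((1%N == (y n).2.+1) = false) by case: (y n).2 yn.
by case: (a n) => /=; ring.
Qed.

(** The two trajectory events of length 0 starting at [y0], one for each first action, have total
    probability 1. *)
Lemma expectation_chain (h : state -> bool -> R)
    (h_ge0 : forall y a, 0 <= h y a) pi y0
    (C : controlled_chain lambda mu pi y0) n : (0 < y0.2)%N ->
  (\int[chain_prob C]_w
     (h (flag C n w, aoi C n w) (action C n w))%:E = (mean h n pi y0)%:E)%E.
Proof.
move=> y0_gt0.
pose F b := trajectory C 0 (fun=> y0) (fun=> b).
have mF b : measurable (F b) by exact: measurable_trajectory.
have PF b : chain_prob C (F b) = (action_prob (pi 0%N) y0 b)%:E.
  by rewrite chain_law eqxx big_ord1 big_ord0 mul1r mulr1.
have dF : [disjoint F true & F false].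
  apply/disj_setPS => w /= [/(_ 0%N (leqnn _)) [_ h1]].
  by move=> /(_ 0%N (leqnn _)) [_]; rewrite h1.
have PD : chain_prob C (F true `|` F false) = 1%E.
  rewrite measureU//; last exact/disj_set2P.
  rewrite [X in (X + _)%E]PF [X in (_ + X)%E]PF /action_prob -EFinD.
  by rewrite addrC subrK.
have mU : measurable (F true `|` F false) by exact: measurableU.
rewrite (@ge0_negligible_integral _ _ _ _ _ (~` (F true `|` F false)))//;
  last 4 first.
- exact: measurableC.
- exact: measurable_chain_fun.
- by move=> x _; rewrite lee_fin.
- by rewrite [LHS](probability_setC _ mU) [X in (_ - X)%E]PD subee.
rewrite setTD setCK ge0_integral_setU//; last 2 first.
- exact: measurable_chain_fun.
- by move=> x _; rewrite lee_fin.
rewrite -[n]add0n !integral_trajectory//.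
rewrite [X in (X * _ + _)%E]PF [X in (_ + X * _)%E]PF -!EFinM -EFinD.
by rewrite add0n meanE.
Qed.

End Expectation.

(** * Discounted metrics *)

Section DiscountedSums.
Context {R : realType}.
Variable beta : R.
Hypothesis beta_bound : 0 < beta < 1.

Definition discounted (u : nat -> R) (n : nat) : R :=
  \sum_(t < n) u t * beta ^+ t.

Lemma discounted_le (u : nat -> R) n :
  (forall t, u t <= 1) -> discounted u n <= (1 - beta)^-1.
Proof.
have /andP[b0 b1] := beta_bound => u1.
apply: (@le_trans _ _ (\sum_(t < n) beta ^+ t)).
  by apply: ler_sum => t _; rewrite ler_piMl// exprn_ge0// ltW.
rewrite -[_^-1]mul1r ler_pdivlMr ?subr_gt0//.
have := subrX1 beta n; have : 0 <= beta ^+ n by rewrite exprn_ge0// ltW.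
by nra.
Qed.

Lemma discounted_nondecreasing (u : nat -> R) :
  (forall t, 0 <= u t) -> nondecreasing_seq (discounted u).
Proof.
have /andP[b0 _] := beta_bound => u0.
apply/nondecreasing_seqP => n; rewrite /discounted big_ord_recr/= lerDl.
by rewrite mulr_ge0// exprn_ge0// ltW.
Qed.

Lemma discounted_is_cvg (u : nat -> R) :
  (forall t, 0 <= u t <= 1) -> cvgn (discounted u).
Proof.
move=> u01; apply: nondecreasing_is_cvgn.
  by apply: discounted_nondecreasing => t; case/andP: (u01 t).
exists (1 - beta)^-1 => _ [n _ <-]; apply: discounted_le => t.
by case/andP: (u01 t).
Qed.

Lemma eseries_discounted (u : nat -> R) : (forall t, 0 <= u t) ->
  (discounted u n)%:E @[n --> \oo] -->
  (\sum_(0 <= t <oo) (u t * beta ^+ t)%:E)%E.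
Proof.
have /andP[b0 _] := beta_bound => u0.
rewrite (_ : (fun n => _) =
  (fun n => \sum_(0 <= t < n) (u t * beta ^+ t)%:E)%E).
  apply: is_cvg_nneseries => n _ _.
  by rewrite lee_fin mulr_ge0// exprn_ge0// ltW.
by apply/funext => n; rewrite /discounted -sumEFin big_mkord.
Qed.

Lemma eseries_discounted_fin (u : nat -> R) : (forall t, 0 <= u t <= 1) ->
  (\sum_(0 <= t <oo) (u t * beta ^+ t)%:E = (limn (discounted u))%:E)%E.
Proof.
move=> u01; transitivity (limn (fun n => (discounted u n)%:E)).
  apply/esym/cvg_lim => //; apply: eseries_discounted => t.
  by case/andP: (u01 t).
apply: cvg_lim => //; apply: cvg_EFin; first exact: nearW.
exact: discounted_is_cvg.
Qed.

Lemma discountedD (u v : nat -> R) (nu : R) n :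
  discounted (fun t => u t + nu * v t) n = discounted u n + nu * discounted v n.
Proof.
rewrite /discounted mulr_sumr -big_split; apply: eq_bigr => t _ /=.
by rewrite mulrDl mulrA.
Qed.

(** The series of [v] is finite because [v] is bounded, so the sum of the two limits is never of the
    form [+oo - oo], even when the series of [u] diverges. *)
Lemma eseries_discountedD (u v : nat -> R) (nu : R) :
  (forall t, 0 <= u t) -> (forall t, 0 <= v t <= 1) ->
  (discounted (fun t => u t + nu * v t) n)%:E @[n --> \oo] -->
  (\sum_(0 <= t <oo) (u t * beta ^+ t)%:E +
   nu%:E * \sum_(0 <= t <oo) (v t * beta ^+ t)%:E)%E.
Proof.
move=> u0 v01.
rewrite (_ : (fun n => _) =
  (fun n => (discounted u n)%:E + nu%:E * (discounted v n)%:E)%E); last first.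
  by apply/funext => n; rewrite discountedD EFinD EFinM.
apply: cvgeD.
- by apply: fin_num_adde_defl; rewrite eseries_discounted_fin.
- exact: eseries_discounted.
- apply: cvgeZl => //.
  by apply: eseries_discounted => t; case/andP: (v01 t).
Qed.

End DiscountedSums.

(** * Cost, work and objective as limits of finite-horizon values *)

Section Metrics.
Context {R : realType}.
Variables lambda mu : R.
Hypothesis lambda_bound : 0 < lambda <= 1.
Hypothesis mu_bound : 0 < mu <= 1.
Local Notation mean := (mean lambda mu).
Local Notation flag_mean := (flag_mean lambda).
Local Notation next_mean := (next_mean lambda mu).

(** Every transition leads to a positive age, so values at age 0 never enter the recursion. *)
Lemma eq_mean (h h' : state -> bool -> R) n pi y :
  (forall y a, (0 < y.2)%N -> h y a = h' y a) -> (0 < y.2)%N ->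
  mean h n pi y = mean h' n pi y.
Proof.
move=> hh'; elim: n pi y => [|n IH] pi y y0 /=;
  first by rewrite /action_mean !hh'.
by rewrite /action_mean /next_mean /flag_mean !IH.
Qed.

Lemma mean_const (k : R) n pi y : mean (fun _ _ => k) n pi y = k.
Proof.
elim: n pi y => [|n IH] pi y /=.
  by rewrite /action_mean /action_prob; ring.
rewrite /action_mean /next_mean /flag_mean !IH /action_prob; ring.
Qed.

Lemma le_mean (h h' : state -> bool -> R) n pi y :
  (forall y a, h y a <= h' y a) -> mean h n pi y <= mean h' n pi y.
Proof.
have /andP[l0 l1] := lambda_bound; have /andP[m0 m1] := mu_bound.
have am (r : rule R) z f g : (forall a, f a <= g a) ->
    action_mean r z f <= action_mean r z g.
  move=> fg; rewrite /action_mean /action_prob; case: ifP => _.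
    by rewrite lerD// ler_wpM2l ?subr_ge0.
  by rewrite !mul0r !add0r subr0 !mul1r.
move=> hh'; elim: n pi y => [|n IH] pi y; apply: am => a; first exact: hh'.
have fm j : flag_mean (mean h n (fun t => pi t.+1)) j <=
            flag_mean (mean h' n (fun t => pi t.+1)) j.
  by rewrite lerD// ler_wpM2l ?subr_ge0//; exact: ltW.
by case: a => //; rewrite lerD// ler_wpM2l ?subr_ge0//; exact: ltW.
Qed.

Lemma meanD (h h' : state -> bool -> R) (nu : R) n pi y :
  mean (fun y a => h y a + nu * h' y a) n pi y =
  mean h n pi y + nu * mean h' n pi y.
Proof.
elim: n pi y => [|n IH] pi y /=; first by rewrite /action_mean; ring.
rewrite /action_mean /next_mean /flag_mean !IH; ring.
Qed.

Definition value (beta : R) (h : state -> bool -> R) (n : nat) (pi : policy R)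
    (y : state) : R :=
  discounted beta (fun t => mean h t pi y) n.

(** One form for all metrics: charge 0 yields the cost metric, zero cost with charge 1 the work
    metric, and a general charge the objective. *)
Definition slot_cost (k : nat -> R) (nu : R) (y : state) (a : bool) : R :=
  k y.2 + nu * a%:R.

(** After the first slot the flag is drawn afresh, so the remaining value depends on the next age
    only, through the flag average [w]. *)
Lemma valueS beta k nu n pi b i :
  value beta (slot_cost k nu) n.+1 pi (b, i) =
  let w := flag_mean (value beta (slot_cost k nu) n (fun t => pi t.+1)) in
  k i + beta * w i.+1 +
  (if b then (pi 0%N i)%:num else 0) * (nu - beta * mu * (w i.+1 - w 1%N)).
Proof.
have value1 h m q y : value beta h m.+1 q y = mean h 0 q y +
    beta * action_mean (q 0%N) y (fun a =>
             next_mean a (value beta h m (fun t => q t.+1)) y.2).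
  rewrite /value /discounted big_ord_recl expr0 mulr1; congr (_ + _).
  transitivity (beta * \sum_(t < m) (mean h t.+1 q y * beta ^+ t)).
    by rewrite mulr_sumr; apply: eq_bigr => t _; rewrite /bump /= exprS; ring.
  congr (_ * _).
  elim: m => [|m IH]; first by rewrite big_ord0 /action_mean /next_mean
      /flag_mean !big_ord0; ring.
  rewrite big_ord_recr IH /= /action_mean /next_mean /flag_mean.
  rewrite !big_ord_recr /=; ring.
rewrite value1 /= /action_mean /action_prob /slot_cost /next_mean /=.
by case: b; ring.
Qed.

Variable beta : R.
Hypothesis beta_bound : 0 < beta < 1.
Variable c : nat -> R.
Hypothesis c_ge0 : forall i, (0 < i)%N -> 0 <= c i.
Variable M : chain_family lambda mu.

(* [c 0] is unconstrained and plays no role, as the AoI is almost surely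
   positive. *)
Definition positive_cost (i : nat) : R := c (maxn 1 i).

Lemma cost_metricE pi y : (0 < y.2)%N ->
  cost_metric beta c M pi y =
  (\sum_(0 <= t <oo)
    (mean (slot_cost positive_cost 0) t pi y * beta ^+ t)%:E)%E.
Proof.
move=> y0; rewrite /cost_metric; set C := M pi y.
have /andP[b0 b1] := beta_bound.
have pc0 i : 0 <= positive_cost i by apply: c_ge0; rewrite leq_max.
have bt t : 0 <= beta ^+ t by rewrite exprn_ge0// ltW.
have mA t : measurable [set w | aoi C t w = 0%N].
  rewrite -[X in measurable X]setTI.
  exact: (@measurable_aoi _ _ _ _ _ C t measurableT [set 0%N]).
(* The expectation of the indicator of age 0, which [mean] cannot distinguish from the zero
   function. *)
have X0 t : chain_prob C [set w | aoi C t w = 0%N] = 0%E.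
  pose h (z : state) (a : bool) : R := (z.2 == 0%N)%:R.
  have := @expectation_chain R lambda mu h _ pi y C t y0.
  rewrite (eq_mean (h' := fun _ _ => 0)) ?mean_const//; last first.
    by move=> [b [|i]].
  rewrite (eq_integral (EFin \o \1_[set w | aoi C t w = 0%N])); last first.
    move=> w _ /=; rewrite /h indicE; congr (_%:R%:E); congr nat_of_bool.
    by apply/eqP/idP => [?|/set_mem//]; apply/mem_set.
  by rewrite integral_indic// setIT; apply.
pose f t w := (positive_cost (aoi C t w) * beta ^+ t)%:E.
have f0 t w : (0 <= f t w)%E by rewrite lee_fin mulr_ge0.
have mf t : measurable_fun setT (f t).
  exact: (@measurable_chain_fun _ _ _ _ _ C (fun z _ =>
    positive_cost z.2 * beta ^+ t)).
have split_cost i : c i = positive_cost i + (c 0%N - c 1%N) * (i == 0%N)%:R.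
  rewrite /positive_cost; case: i => [|i] /=;
    first by rewrite mulr1 addrC subrK.
  by rewrite mulr0 addr0 (maxn_idPr _).
transitivity (\int[chain_prob C]_w \sum_(0 <= t <oo) f t w)%E.
  apply: ae_eq_integral => //.
  (* As [c 0] may be negative, the terms of the series have no fixed sign. Measurability comes from
     convergence of the partial sums, which holds because the correction at age 0 is a multiple of
     an indicator. *)
  - apply: (@emeasurable_fun_cvg _ _ _ _ (fun n w =>
      (discounted beta (fun t => c (aoi C t w)) n)%:E)).
      move=> n; rewrite (_ : (fun w => _) =
        (fun w => \sum_(t < n) (c (aoi C t w) * beta ^+ t)%:E)%E); last first.
        by apply/funext => w; rewrite sumEFin.
      apply: emeasurable_sum => t _.
      exact: (@measurable_chain_fun _ _ _ _ _ C (fun z _ => c z.2 * beta ^+ t)).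
    move=> w _.
    have cE : (fun t => c (aoi C t w)) = (fun t => positive_cost (aoi C t w) +
        (c 0%N - c 1%N) * (aoi C t w == 0%N)%:R).
      by apply/funext => t.
    have := @eseries_discountedD R beta beta_bound (fun t =>
      positive_cost (aoi C t w))
      (fun t => (aoi C t w == 0%N)%:R) (c 0%N - c 1%N).
    rewrite -cE => /(_ _ _)/wrap[]//.
      by move=> t; case: eqP; rewrite ?lexx ler01.
    move=> /cvgP cv; rewrite -[X in _ --> X](_ : limn (fun n =>
      (discounted beta (fun t => c (aoi C t w)) n)%:E) = _)//.
    by apply/congr_lim/funext => n; rewrite big_mkord sumEFin.
  - exact: ge0_emeasurable_sum.
  - have /negligible_bigcup N : forall t,
        (chain_prob C).-negligible [set w | aoi C t w = 0%N].
      move=> t; exists [set w | aoi C t w = 0%N].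
      by split; [exact: mA|exact: X0|].
    apply: negligibleS N => w /= /not_implyP[_ H].
    apply: contrapT => w0; apply: H; apply: eq_eseriesr => t _.
    rewrite /f /positive_cost (maxn_idPr _)// lt0n.
    by apply/eqP => w0'; apply: w0; exists t.
rewrite integral_nneseries//; apply: eq_eseriesr => t _.
rewrite EFinM -(@expectation_chain _ _ _ _ _ _ _ C)//; last first.
  by move=> z a; rewrite /slot_cost mul0r addr0.
rewrite muleC -ge0_integralZl//; last 3 first.
- exact: measurable_chain_fun.
- by move=> w _; rewrite lee_fin /slot_cost mul0r addr0.
- exact: bt.
apply: eq_integral => w _; rewrite /f /slot_cost mul0r addr0.
by rewrite -EFinM mulrC.
Qed.

Lemma work_metricE pi y : (0 < y.2)%N ->
  work_metric beta M pi y =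
  (\sum_(0 <= t <oo) (mean (slot_cost (fun=> 0) 1) t pi y * beta ^+ t)%:E)%E.
Proof.
move=> y0; rewrite /work_metric; set C := M pi y.
have /andP[b0 b1] := beta_bound.
have bt t : 0 <= beta ^+ t by rewrite exprn_ge0// ltW.
rewrite integral_nneseries//; last 2 first.
- move=> t.
  exact: (@measurable_chain_fun _ _ _ _ _ C (fun _ a => a%:R * beta ^+ t)).
- by move=> t w _; rewrite lee_fin mulr_ge0.
apply: eq_eseriesr => t _.
rewrite EFinM -(@expectation_chain _ _ _ _ _ _ _ C)//; last first.
  by move=> z a; rewrite /slot_cost mul1r add0r.
rewrite muleC -ge0_integralZl//; last 3 first.
- exact: measurable_chain_fun.
- by move=> w _; rewrite lee_fin /slot_cost mul1r add0r.
- exact: bt.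
apply: eq_integral => w _; rewrite /slot_cost mul1r add0r.
by rewrite -EFinM mulrC.
Qed.

Lemma work_bound t pi y : 0 <= mean (slot_cost (fun=> 0) 1) t pi y <= 1.
Proof.
apply/andP; split.
  by rewrite -[leLHS](mean_const 0 t pi y) le_mean// => z [];
     rewrite /slot_cost /=; lra.
by rewrite -[leRHS](mean_const 1 t pi y) le_mean// => z [];
   rewrite /slot_cost /=; lra.
Qed.

Lemma work_cvg pi y :
  cvgn (fun n => value beta (slot_cost (fun=> 0) 1) n pi y).
Proof. by apply: discounted_is_cvg => // t; exact: work_bound. Qed.

Lemma work_metric_lim pi y : (0 < y.2)%N ->
  work_metric beta M pi y =
  (limn (fun n => value beta (slot_cost (fun=> 0) 1) n pi y))%:E.
Proof.
move=> y0; rewrite work_metricE// (eseries_discounted_fin beta_bound)//.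
by move=> t; exact: work_bound.
Qed.

Lemma valueD k nu n pi y : value beta (slot_cost k nu) n pi y =
  value beta (slot_cost k 0) n pi y +
  nu * value beta (slot_cost (fun=> 0) 1) n pi y.
Proof.
rewrite /value -discountedD; apply: eq_bigr => t _; congr (_ * _).
rewrite -meanD; congr (mean _ _ _ _).
by apply/funext => z; apply/funext => a; rewrite /slot_cost; ring.
Qed.

Lemma cost_metric_cvg pi y : (0 < y.2)%N ->
  (value beta (slot_cost positive_cost 0) n pi y)%:E @[n --> \oo] -->
  cost_metric beta c M pi y.
Proof.
move=> y0; rewrite cost_metricE//; apply: eseries_discounted => // t.
rewrite -[leLHS](mean_const 0 t pi y) le_mean// => z a.
by rewrite /slot_cost mul0r addr0 c_ge0// leq_max.
Qed.

Lemma objective_cvg nu pi y : (0 < y.2)%N ->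
  (value beta (slot_cost positive_cost nu) n pi y)%:E @[n --> \oo] -->
  objective beta c M nu pi y.
Proof.
move=> y0; rewrite /objective cost_metricE// work_metricE//.
rewrite (_ : (fun n => _) = (fun n => (discounted beta (fun t =>
  mean (slot_cost positive_cost 0) t pi y +
  nu * mean (slot_cost (fun=> 0) 1) t pi y) n)%:E)); last first.
  by apply/funext => n; rewrite valueD -discountedD.
apply: eseries_discountedD => // t; last exact: work_bound.
rewrite -[leLHS](mean_const 0 t pi y) le_mean// => z a.
by rewrite /slot_cost mul0r addr0 c_ge0// leq_max.
Qed.

End Metrics.

(** * Value iteration *)

Lemma cvg_min0 (R : realType) (u : nat -> R) (l : R) :
  u n @[n --> \oo] --> l -> Num.min 0 (u n) @[n --> \oo] --> Num.min 0 l.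
Proof.
move=> ul; apply: (cvg_comp _ (fun x : R => Num.min 0 x) ul).
by apply: (@continuous_min R R (cst 0) id); [exact: cvg_cst|exact: cvg_id].
Qed.

Lemma le_geometric (R : realType) (beta x l K : R) : 0 < beta < 1 ->
  (forall n, x <= l + beta ^+ n * K) -> x <= l.
Proof.
move=> /andP[b0 b1] xK; apply: (@ler_cvg_to nat \oo _ R (cst x)
  (fun n => l + beta ^+ n * K)) => //; first exact: cvg_cst.
  rewrite -[X in _ --> X]addr0; apply: cvgD; first exact: cvg_cst.
  rewrite -[X in _ --> X](mul0r K); apply: cvgM; last exact: cvg_cst.
  by apply: cvg_expr; rewrite gtr0_norm.
exact: nearW.
Qed.

(** A maximum principle without an attained maximum: iterating the one-step improvement from the
    bound [K] gives [beta ^+ n * K] for every [n]. *)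
Lemma contraction_le0 (R : realType) (beta K : R) (f : nat -> R) :
  0 < beta < 1 -> 0 <= K -> (forall i, (0 < i)%N -> f i <= K) ->
  (forall e, 0 <= e -> (forall i, (0 < i)%N -> f i <= e) ->
    forall i, (0 < i)%N -> f i <= beta * e) ->
  forall i, (0 < i)%N -> f i <= 0.
Proof.
move=> b01 K0 fK step i i0; have /andP[b0 _] := b01.
apply: (@le_geometric _ beta _ _ K b01) => n; rewrite add0r.
elim: n i i0 => [|n IH] i i0; first by rewrite expr0 mul1r fK.
rewrite exprS -mulrA; apply: step => //.
by rewrite mulr_ge0// exprn_ge0// ltW.
Qed.

(* The bounds on the increments of [f] are uniform, so [f] is continuous and
   takes both signs. *)
Lemma increasing_has_root (R : realType) (f : R -> R) (a L : R) :
  0 < a -> (forall x y, x <= y -> a * (y - x) <= f y - f x <= L * (y - x)) ->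
  exists x, f x = 0.
Proof.
move=> a0 fL; have L0 : 0 < L.
  by have /andP[] := fL 0 1 ler01; rewrite subr0; lra.
have cf : continuous f.
  move=> x; apply/cvgrPdist_le => e e0.
  near=> y.
  have yx : `|x - y| <= e / L by near: y; apply: cvgr_dist_le => //;
    rewrite divr_gt0.
  move: yx; rewrite ler_pdivlMr// => yx; rewrite ler_norml.
  have [xy|/ltW xy] := leP x y; have /andP[h1 h2] := fL _ _ xy.
    by rewrite ler0_norm ?subr_le0// in yx; nra.
  by rewrite ger0_norm ?subr_ge0// in yx; nra.
(* Growth at rate at least [a] over a distance [b] makes up for the value at 0, so [f] changes sign
   on [[- b, b]]. *)
pose b := `|f 0| / a; have b0 : 0 <= b by rewrite divr_ge0// ltW.
have ab : a * b = `|f 0| by rewrite /b mulrC divfK// gt_eqF.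
have fb : 0 <= f b.
  have /andP[+ _] := fL 0 b b0; rewrite subr0 ab.
  by have := ler_norm (- f 0); rewrite normrN; lra.
have fNb : f (- b) <= 0.
  have nb : - b <= 0 by rewrite oppr_le0.
  have /andP[+ _] := fL _ _ nb; rewrite sub0r opprK ab; have := ler_norm (f 0).
  lra.
have [|||x _ fx] := @IVT R f (- b) b 0; last by exists x.
- by lra.
- exact: continuous_subspaceT.
- by rewrite (min_l (le_trans fNb fb)) (max_r (le_trans fNb fb)) fNb.
Unshelve. all: by end_near. Qed.

(** * One-step operators on functions of the age *)

Section DynamicProgramming.
Context {R : realType}.
Variables lambda mu beta : R.
Hypothesis lambda_bound : 0 < lambda <= 1.
Hypothesis mu_bound : 0 < mu <= 1.
Hypothesis beta_bound : 0 < beta < 1.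

Definition net_charge (nu : R) (w : nat -> R) (i : nat) : R :=
  nu - beta * mu * (w i.+1 - w 1%N).

(** Here [x] is the probability of attempting when a packet is present. Putting [b%:R] for [lambda]
    gives the step from a state whose flag [b] is known. *)
Definition policy_step (k : nat -> R) (nu x : R) (w : nat -> R) (i : nat) : R :=
  k i + beta * w i.+1 + lambda * x * net_charge nu w i.

(** The values at ages [i.+1] and 1 enter with the weights [1 - lambda * x * mu] and
    [lambda * x * mu] times [beta], which are nonnegative. *)
Lemma policy_step_homo k nu x (w w' : nat -> R) i : 0 <= x <= 1 ->
  w i.+1 <= w' i.+1 -> w 1%N <= w' 1%N ->
  policy_step k nu x w i <= policy_step k nu x w' i.
Proof.
have /andP[l0 l1] := lambda_bound; have /andP[m0 m1] := mu_bound.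
have /andP[b0 b1] := beta_bound; move=> /andP[x0 x1] h1 h2.
have y0 : 0 <= lambda * x * mu by rewrite !mulr_ge0// ltW.
have y1 : lambda * x * mu <= 1 by rewrite !mulr_ile1 ?mulr_ge0// ltW.
rewrite /policy_step /net_charge -subr_ge0.
rewrite (_ : _ - _ = beta * ((1 - lambda * x * mu) * (w' i.+1 - w i.+1) +
   lambda * x * mu * (w' 1%N - w 1%N))); last by ring.
by rewrite mulr_ge0 ?(ltW b0)// addr_ge0// mulr_ge0// subr_ge0.
Qed.

Lemma policy_step_shift k nu x (w : nat -> R) (a : R) i :
  policy_step k nu x (fun j => w j + a) i = policy_step k nu x w i + beta * a.
Proof. by rewrite /policy_step /net_charge; ring. Qed.

Definition bellman k nu (w : nat -> R) (i : nat) : R :=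
  k i + beta * w i.+1 + lambda * Num.min 0 (net_charge nu w i).

Lemma bellman_le_policy_step k nu x w i : 0 <= x <= 1 ->
  bellman k nu w i <= policy_step k nu x w i.
Proof.
have /andP[l0 l1] := lambda_bound; move=> /andP[x0 x1].
rewrite lerD2l -mulrA ler_wpM2l ?(ltW l0)//.
have [g0|g0] := ltP 0 (net_charge nu w i); first by rewrite mulr_ge0// ltW.
have : 0 <= (1 - x) * - net_charge nu w i by rewrite mulr_ge0
  ?subr_ge0 ?oppr_ge0.
by lra.
Qed.

Lemma bellman_policy_stepE k nu w i :
  bellman k nu w i = policy_step k nu (net_charge nu w i < 0)%R%:R w i.
Proof.
rewrite /bellman /policy_step; have [_|_|g0] := ltgtP (net_charge nu w i) 0.
- by rewrite mulr1.
- by rewrite !mulr0 mul0r.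
- by rewrite g0 !mulr0.
Qed.

(** The minimizing action for [w'] is also available for [w], which reduces the claim to a single
    policy step. *)
Lemma bellman_homo k nu (w w' : nat -> R) i :
  w i.+1 <= w' i.+1 -> w 1%N <= w' 1%N -> bellman k nu w i <= bellman k nu w' i.
Proof.
move=> h1 h2; rewrite [leRHS]bellman_policy_stepE.
set x : R := _%:R.
have x01 : 0 <= x <= 1 by rewrite /x; case: ltP; rewrite lexx ler01.
exact: le_trans (bellman_le_policy_step k nu w i x01)
  (policy_step_homo k nu x01 h1 h2).
Qed.

(* Differences of optimal values between two charges [d] apart, as well as the
   work metric of a fixed policy (with [d = 1]), solve such an equation; [x i] is
   a secant slope, resp. the probability of attempting at age [i]. *)
Lemma sensitivity_bounds (U x : nat -> R) (d K : R) : 0 <= d ->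
  (forall i, (0 < i)%N -> 0 <= x i <= 1) ->
  (forall i, (0 < i)%N -> `|U i| <= K) ->
  (forall i, (0 < i)%N -> U i = policy_step (fun=> 0) d (x i) U i) ->
  forall i, (0 < i)%N ->
    (1 - beta) / (1 - beta * (1 - lambda * mu)) * d <= net_charge d U i <=
    d + beta * mu * K.
Proof.
have /andP[l0 l1] := lambda_bound; have /andP[m0 m1] := mu_bound.
have /andP[b0 b1] := beta_bound; move=> d0 x01 UK Urec.
have K0 : 0 <= K by apply: le_trans (UK 1%N isT).
have p0 : 0 < lambda * mu by rewrite mulr_gt0.
have p1 : lambda * mu <= 1 by rewrite mulr_ile1// ltW.
set p := lambda * mu in p0 p1 *.
have q0 : 0 < 1 - beta * (1 - p) by nra.
have act0 e (w : nat -> R) i : policy_step (fun=> 0) e (x i) w i =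
    beta * (1 - p * x i) * w i.+1 + x i * (lambda * e + beta * p * w 1%N).
  by rewrite /policy_step /net_charge /p; ring.
have U0 i : (0 < i)%N -> 0 <= U i.
  move=> i0; rewrite -oppr_le0; move: i i0.
  apply: (@contraction_le0 _ beta K) => // [i i0|e e0 He i i0].
    by have := UK i i0; rewrite ler_norml; lra.
  have /andP[x0 x1] := x01 i i0.
  rewrite Urec// act0.
  have h1 := He i.+1 isT; have h2 := He 1%N isT.
  have px0 : 0 <= p * x i by rewrite mulr_ge0// ltW.
  have px1 : p * x i <= 1 by rewrite mulr_ile1// ltW.
  have ld : 0 <= x i * (lambda * d) by rewrite !mulr_ge0// ltW.
  have h3 : (1 - p * x i) * - U i.+1 <= (1 - p * x i) * e.
    by rewrite ler_wpM2l// subr_ge0.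
  have h4 : p * x i * - U 1%N <= p * x i * e by rewrite ler_wpM2l.
  by nra.
(* The constant solution for [x = 1] at every age with [U 1] held fixed. Replacing 1 by [x i] lowers
   the right-hand side at [S] by [(1 - beta) * (1 - x i) * S], so [S] dominates [U]. *)
pose S := (lambda * d + beta * p * U 1%N) / (1 - beta * (1 - p)).
have SE : S * (1 - beta * (1 - p)) = lambda * d + beta * p * U 1%N.
  by rewrite /S divfK// gt_eqF.
have S0 : 0 <= S.
  apply: divr_ge0; last exact: ltW.
  by rewrite addr_ge0 ?mulr_ge0 ?U0// ltW.
have US i : (0 < i)%N -> U i <= S.
  move=> i0; rewrite -subr_le0; move: i i0.
  apply: (@contraction_le0 _ beta K) => // [i i0|e e0 He i i0].
    by have := UK i i0; rewrite ler_norml; lra.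
  have /andP[x0 x1] := x01 i i0.
  rewrite Urec// act0 -SE.
  have h1 := He i.+1 isT.
  have px0 : 0 <= p * x i by rewrite mulr_ge0// ltW.
  have px1 : p * x i <= 1 by rewrite mulr_ile1// ltW.
  have h3 : (1 - p * x i) * (U i.+1 - S) <= (1 - p * x i) * e.
    by rewrite ler_wpM2l// subr_ge0.
  have h4 : x i * S <= S by rewrite ler_piMl.
  have h5 : 0 <= p * x i * e by rewrite mulr_ge0.
  have h6 : beta * ((1 - p * x i) * (U i.+1 - S)) <= beta * e.
    by rewrite ler_wpM2l ?(ltW b0)//; lra.
  have h7 : 0 <= (1 - beta) * (S - x i * S).
    by rewrite mulr_ge0 ?subr_ge0// ltW.
  by lra.
move=> i i0; have := US i.+1 isT; have := U0 1%N isT; have := U0 i.+1 isT.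
have := UK 1%N isT; rewrite ler_norml => /andP[_ U1K] Ui U1 UiS.
have bm : 0 <= beta * mu by rewrite mulr_ge0// ltW.
rewrite /net_charge; apply/andP; split; last first.
  have : beta * mu * U 1%N <= beta * mu * K by rewrite ler_wpM2l.
  have : 0 <= beta * mu * U i.+1 by rewrite mulr_ge0.
  by lra.
have h1 : beta * mu * U i.+1 <= beta * mu * S by rewrite ler_wpM2l.
rewrite mulrAC ler_pdivrMr//.
have h2 : beta * mu * U i.+1 * (1 - beta * (1 - p)) <=
          beta * mu * (lambda * d + beta * p * U 1%N).
  by rewrite -SE mulrA ler_wpM2r// ltW.
(* After multiplication by [1 - beta * (1 - p)], the terms in [d] leave [(1 - beta) * d], and those
   in [U 1] leave exactly this quantity. *)
have h3 : 0 <= beta * mu * (1 - beta) * U 1%N.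
  by apply: mulr_ge0 => //; apply: mulr_ge0 => //; rewrite subr_ge0 ltW.
by rewrite /p in h2 *; lra.
Qed.

End DynamicProgramming.

(** * The optimal value as an increasing limit, and its dependence on age and charge *)

Section ValueIteration.
Context {R : realType}.
Variables lambda mu beta : R.
Hypothesis lambda_bound : 0 < lambda <= 1.
Hypothesis mu_bound : 0 < mu <= 1.
Hypothesis beta_bound : 0 < beta < 1.
Variables k S : nat -> R.
Hypothesis k_ge0 : forall i, 0 <= k i.
Hypothesis k_le : forall i j, (i <= j)%N -> k i <= k j.
Hypothesis S_ge0 : forall i, 0 <= S i.
Hypothesis S_super : forall i, k i + (1 - lambda * mu) * S i.+1 <= S i.

Local Notation net_charge := (net_charge mu beta).
Local Notation policy_step := (policy_step lambda mu beta).
Local Notation bellman := (bellman lambda mu beta).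
(** Bounds the discounted total of charges of absolute value at most that of [nu] in each slot. *)
Local Notation slack nu := (`|nu| / (1 - beta)).

(* Starting below every value function makes the iterates increase. *)
Fixpoint iterate (nu : R) (n : nat) : nat -> R :=
  if n is n'.+1 then bellman k nu (iterate nu n') else fun=> - slack nu.

Lemma slack_ge0 (nu : R) : 0 <= slack nu.
Proof. by case/andP: beta_bound => _ b1; rewrite divr_ge0 // subr_ge0 ltW. Qed.

Lemma slackE (nu : R) : slack nu = `|nu| + beta * slack nu.
Proof.
have /andP[_ b1] := beta_bound.
have : slack nu * (1 - beta) = `|nu| by rewrite divfK// subr_eq0 gt_eqF.
by lra.
Qed.

Lemma charge_bound nu x : 0 <= x <= 1 -> - `|nu| <= lambda * x * nu <= `|nu|.
Proof.
have /andP[l0 l1] := lambda_bound; move=> /andP[x0 x1].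
rewrite -ler_norml normrM ger0_norm ?mulr_ge0//; last exact: ltW.
by rewrite ler_piMl// mulr_ile1// ltW.
Qed.

Lemma iterate_nondecreasing nu i : nondecreasing_seq (fun n => iterate nu n i).
Proof.
have /andP[b0 b1] := beta_bound.
apply/nondecreasing_seqP => n; elim: n i => [|n IH] i.
  rewrite /= bellman_policy_stepE; set x : R := _%:R.
  have /(charge_bound nu)/andP[+ _] : 0 <= x <= 1.
    by rewrite /x; case: ltP; rewrite lexx ler01.
  have := k_ge0 i; have := slackE nu.
  by rewrite /policy_step /net_charge; lra.
exact: (bellman_homo lambda_bound mu_bound beta_bound k nu (IH i.+1) (IH 1%N)).
Qed.

(* Comparison with the policy that always attempts, for which [S] is a
   supersolution. *)
Lemma iterate_le nu n i : iterate nu n i <=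
  S i + (beta * (lambda * mu) * S 1%N + `|nu|) / (1 - beta).
Proof.
have /andP[l0 l1] := lambda_bound; have /andP[m0 m1] := mu_bound.
have /andP[b0 b1] := beta_bound.
have p0 : 0 <= lambda * mu by rewrite mulr_ge0// ltW.
have p1 : lambda * mu <= 1 by rewrite mulr_ile1// ltW.
(* [S] accounts only for the costs up to the first success; [K] covers the charges and the restarts
   at age 1, both discounted. *)
set K := _ / _.
have KE : K * (1 - beta) = beta * (lambda * mu) * S 1%N + `|nu|.
  by rewrite /K divfK// subr_eq0 gt_eqF.
have K0 : 0 <= K.
  apply: divr_ge0; last by rewrite subr_ge0 ltW.
  by rewrite addr_ge0// mulr_ge0// mulr_ge0// ltW.
elim: n i => [|n IH] i.
  rewrite /= (@le_trans _ _ 0) ?oppr_le0 ?slack_ge0//.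
  by rewrite addr_ge0.
have x01 : (0 : R) <= 1 <= (1 : R) by rewrite lexx ler01.
apply: le_trans (bellman_le_policy_step mu beta lambda_bound k nu
  (iterate nu n) i x01) _.
apply: le_trans (policy_step_homo lambda_bound mu_bound beta_bound k nu x01
  (w' := fun j => S j + K) (IH i.+1) (IH 1%N)) _.
rewrite (policy_step_shift _ _ _ k nu 1 S K).
have /andP[_ +] := charge_bound nu x01.
have := S_super i.
have : beta * ((1 - lambda * mu) * S i.+1) <= (1 - lambda * mu) * S i.+1.
  by rewrite ler_piMl ?(ltW b1)// mulr_ge0// subr_ge0.
by rewrite /policy_step /net_charge; lra.
Qed.

Definition optimal_value (nu : R) (i : nat) : R :=
  limn (fun n => iterate nu n i).

Lemma iterate_cvg nu i : iterate nu n i @[n --> \oo] --> optimal_value nu i.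
Proof.
apply: nondecreasing_is_cvgn; first exact: iterate_nondecreasing.
by eexists => _ [n _ <-]; exact: iterate_le.
Qed.

Lemma iterate_le_optimal nu n i : iterate nu n i <= optimal_value nu i.
Proof.
apply: (nondecreasing_cvgn_le (iterate_nondecreasing nu i)).
by apply: cvgP; exact: iterate_cvg.
Qed.

Lemma net_charge_cvg nu (u : nat -> nat -> R) (w : nat -> R) i :
  u n i.+1 @[n --> \oo] --> w i.+1 -> u n 1%N @[n --> \oo] --> w 1%N ->
  net_charge nu (u n) i @[n --> \oo] --> net_charge nu w i.
Proof.
move=> u1 u2; apply: cvgB; first exact: cvg_cst.
by apply: cvgM; [exact: cvg_cst|exact: cvgB].
Qed.

Lemma policy_step_cvg nu x (u : nat -> nat -> R) (w : nat -> R) i :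
  u n i.+1 @[n --> \oo] --> w i.+1 -> u n 1%N @[n --> \oo] --> w 1%N ->
  policy_step k nu x (u n) i @[n --> \oo] --> policy_step k nu x w i.
Proof.
move=> u1 u2; apply: cvgD.
  by apply: cvgD; [exact: cvg_cst|apply: cvgM => //; exact: cvg_cst].
by apply: cvgM; [exact: cvg_cst|exact: net_charge_cvg].
Qed.

Lemma bellman_cvg nu (u : nat -> nat -> R) (w : nat -> R) i :
  u n i.+1 @[n --> \oo] --> w i.+1 -> u n 1%N @[n --> \oo] --> w 1%N ->
  bellman k nu (u n) i @[n --> \oo] --> bellman k nu w i.
Proof.
move=> u1 u2; apply: cvgD.
  by apply: cvgD; [exact: cvg_cst|apply: cvgM => //; exact: cvg_cst].
apply: cvgM; first exact: cvg_cst.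
by apply: cvg_min0; exact: net_charge_cvg.
Qed.

Lemma optimal_valueE nu i :
  optimal_value nu i = bellman k nu (optimal_value nu) i.
Proof.
have := @bellman_cvg nu (iterate nu) (optimal_value nu) i
  (@iterate_cvg nu i.+1) (@iterate_cvg nu 1%N).
have := @iterate_cvg nu i; rewrite -cvg_shiftS => c1 c2.
by rewrite -(cvg_lim _ c1)// -(cvg_lim _ c2).
Qed.

Lemma optimal_value_ge nu i : - slack nu <= optimal_value nu i.
Proof. exact: (iterate_le_optimal nu 0%N i). Qed.

(** The action that is best at the larger age [j] can be imitated at [i], where the slot cost and
    the next value are no larger. *)
Lemma iterate_le_age nu n i j : (i <= j)%N -> iterate nu n i <= iterate nu n j.
Proof.
have /andP[l0 l1] := lambda_bound; have /andP[m0 m1] := mu_bound.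
have /andP[b0 b1] := beta_bound.
elim: n i j => [//|n IH] i j ij.
rewrite /= [leRHS]bellman_policy_stepE; set x : R := _%:R.
have x01 : 0 <= x <= 1 by rewrite /x; case: ltP; rewrite lexx ler01.
apply: le_trans (bellman_le_policy_step mu beta lambda_bound k nu
  (iterate nu n) i x01) _.
have := IH i.+1 j.+1 ij; have := k_le ij; have /andP[x0 x1] := x01 => kij h.
have y1 : lambda * x * mu <= 1 by rewrite !mulr_ile1 ?mulr_ge0// ltW.
have : 0 <= beta * ((1 - lambda * x * mu) *
  (iterate nu n j.+1 - iterate nu n i.+1)).
  by rewrite mulr_ge0 ?(ltW b0)// mulr_ge0// subr_ge0.
by rewrite /policy_step /net_charge; lra.
Qed.

Lemma optimal_value_le_age nu i j : (i <= j)%N ->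
  optimal_value nu i <= optimal_value nu j.
Proof.
move=> ij; apply: (ler_cvg_to (@iterate_cvg nu i) (@iterate_cvg nu j)).
by apply: nearW => n; exact: iterate_le_age.
Qed.

Definition optimal_net_charge (nu : R) (i : nat) : R :=
  net_charge nu (optimal_value nu) i.

Lemma optimal_net_charge_ge_age nu i j : (i <= j)%N ->
  optimal_net_charge nu j <= optimal_net_charge nu i.
Proof.
have /andP[m0 m1] := mu_bound; have /andP[b0 b1] := beta_bound.
move=> ij; have h := @optimal_value_le_age nu i.+1 j.+1 ij.
have : 0 <= beta * mu * (optimal_value nu j.+1 - optimal_value nu i.+1).
  by rewrite mulr_ge0 ?subr_ge0// mulr_ge0// ltW.
by rewrite /optimal_net_charge /net_charge; lra.
Qed.

(** [J] stands for the finite-horizon values of a stationary rule. They start at 0, above the start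
    of [iterate], and a Bellman step never exceeds a policy step. *)
Lemma iterate_le_policy nu (x : nat -> R) (J : nat -> nat -> R) :
  (forall i, 0 <= x i <= 1) -> (forall i, J 0%N i = 0) ->
  (forall n i, J n.+1 i = policy_step k nu (x i) (J n) i) ->
  forall n i, iterate nu n i <= J n i.
Proof.
move=> x01 J0 JS; elim=> [|n IH] i; first by rewrite J0 oppr_le0 slack_ge0.
rewrite JS; apply: le_trans (bellman_le_policy_step mu beta lambda_bound k nu
  _ i (x01 i)) _.
exact: (policy_step_homo lambda_bound mu_bound beta_bound k nu (x01 i)
  (IH i.+1) (IH 1%N)).
Qed.

(** A greedy step fixes [optimal_value] and shrinks an additive constant by [beta]; the initial
    error is at most [slack nu] although the values may be unbounded in the age. *)
Lemma greedy_le nu (x : nat -> R) (J : nat -> nat -> R) :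
  (forall i, 0 <= x i <= 1) -> (forall i, J 0%N i = 0) ->
  (forall n i, J n.+1 i = policy_step k nu (x i) (J n) i) ->
  (forall i, (0 < i)%N ->
    x i * optimal_net_charge nu i = Num.min 0 (optimal_net_charge nu i)) ->
  forall n i, (0 < i)%N -> J n i <= optimal_value nu i + beta ^+ n * slack nu.
Proof.
move=> x01 J0 JS greedy; elim=> [|n IH] i i0.
  by rewrite J0 expr0 mul1r -lerBlDr sub0r optimal_value_ge.
rewrite JS; apply: le_trans (policy_step_homo lambda_bound mu_bound beta_bound
  k nu (x01 i) (w' := fun j => optimal_value nu j + beta ^+ n * slack nu)
  (IH i.+1 isT) (IH 1%N isT)) _.
rewrite (policy_step_shift _ _ _ k nu (x i) (optimal_value nu)).
by rewrite exprS -mulrA lerD2r optimal_valueE /bellman -greedy// mulrA.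
Qed.

Lemma greedy_cvg nu (x : nat -> R) (J : nat -> nat -> R) :
  (forall i, 0 <= x i <= 1) -> (forall i, J 0%N i = 0) ->
  (forall n i, J n.+1 i = policy_step k nu (x i) (J n) i) ->
  (forall i, (0 < i)%N ->
    x i * optimal_net_charge nu i = Num.min 0 (optimal_net_charge nu i)) ->
  forall i, (0 < i)%N -> J n i @[n --> \oo] --> optimal_value nu i.
Proof.
have /andP[b0 b1] := beta_bound.
move=> x01 J0 JS greedy i i0.
apply: (@squeeze_cvgr _ _ _ _ (fun n => iterate nu n i)
   (fun n => optimal_value nu i + beta ^+ n * slack nu)).
- apply: nearW => n; rewrite (iterate_le_policy x01 J0 JS)/=.
  exact: (greedy_le x01 J0 JS greedy).
- exact: iterate_cvg.
- rewrite -[X in _ --> X]addr0; apply: cvgD; first exact: cvg_cst.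
  rewrite -[X in _ --> X](mul0r (slack nu)); apply: cvgM; last exact: cvg_cst.
  by apply: cvg_expr; rewrite gtr0_norm.
Qed.

(** * Dependence of the optimal value on the charge *)

Lemma min0_secant (g g' : R) : exists2 x, 0 <= x <= 1 &
  Num.min 0 g' - Num.min 0 g = x * (g' - g).
Proof.
wlog gg' : g g' / g <= g'.
  have [gg' h|/ltW gg' h] := leP g g'; first exact: h.
  have [x x01 e] := h g' g gg'; exists x => //.
  by rewrite -opprB e; ring.
have [eg|ng] := eqVneq g' g.
  by exists 0; rewrite ?eg; [rewrite lexx ler01|ring].
have dg : 0 < g' - g by rewrite subr_gt0 lt_neqAle eq_sym ng.
exists ((Num.min 0 g' - Num.min 0 g) / (g' - g)); last first.
  by rewrite divfK// gt_eqF.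
rewrite ler_pdivlMr// ler_pdivrMr// mul0r mul1r.
by have [h|h] := ltP 0 g; have [h'|h'] := ltP 0 g'; apply/andP; split; lra.
Qed.

(** As [Num.min 0] is nondecreasing and 1-Lipschitz, its secant slope acts as an attempt
    probability, and the difference of two Bellman steps becomes a linear policy step. *)
Lemma iterate_secant nu nu' n i : exists2 x, 0 <= x <= 1 &
  iterate nu' n.+1 i - iterate nu n.+1 i =
  policy_step (fun=> 0) (nu' - nu) x (fun j =>
    iterate nu' n j - iterate nu n j) i.
Proof.
have [x x01 e] := min0_secant (net_charge nu (iterate nu n) i)
  (net_charge nu' (iterate nu' n) i).
exists x => //=; rewrite /bellman /policy_step.
rewrite (_ : _ - _ = 0 + beta * (iterate nu' n i.+1 - iterate nu n i.+1) +
  lambda * (Num.min 0 (net_charge nu' (iterate nu' n) i) -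
            Num.min 0 (net_charge nu (iterate nu n) i))); last by ring.
by rewrite e /net_charge; ring.
Qed.

Lemma optimal_value_secant nu nu' i : exists2 x, 0 <= x <= 1 &
  optimal_value nu' i - optimal_value nu i =
  policy_step (fun=> 0) (nu' - nu) x (fun j =>
    optimal_value nu' j - optimal_value nu j) i.
Proof.
have [x x01 e] := min0_secant (optimal_net_charge nu i)
  (optimal_net_charge nu' i).
exists x => //=; rewrite !(optimal_valueE _ i) /bellman /policy_step.
rewrite (_ : _ - _ = 0 +
  beta * (optimal_value nu' i.+1 - optimal_value nu i.+1) +
  lambda * (Num.min 0 (optimal_net_charge nu' i) -
            Num.min 0 (optimal_net_charge nu i))); last first.
  by rewrite /optimal_net_charge; ring.
by rewrite e /optimal_net_charge /net_charge; ring.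
Qed.

(** A secant step preserves the bound by [slackE]. Uniformity in the age is what
    [sensitivity_bounds] needs: differences between charges are bounded even where the values
    themselves are not. *)
Lemma iterate_lipschitz nu nu' n i :
  `|iterate nu' n i - iterate nu n i| <= slack (nu' - nu).
Proof.
have /andP[l0 l1] := lambda_bound; have /andP[m0 m1] := mu_bound.
have /andP[b0 b1] := beta_bound.
elim: n i => [|n IH] i.
  rewrite /= -opprD normrN; rewrite -mulrBl normrM.
  rewrite [X in _ * X]ger0_norm ?invr_ge0 ?subr_ge0 ?(ltW b1)//.
  by rewrite ler_wpM2r ?invr_ge0 ?subr_ge0 ?(ltW b1)// ler_dist_dist.
have [x x01 ->] := iterate_secant nu nu' n i; have /andP[x0 x1] := x01.
set U := (fun j => iterate nu' n j - iterate nu n j).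
have K0 := slack_ge0 (nu' - nu); have KE := slackE (nu' - nu).
set K := slack _ in K0 KE IH *.
have UK j : - K <= U j <= K by rewrite -ler_norml; exact: IH.
have hl := policy_step_homo lambda_bound mu_bound beta_bound (fun=> 0)
  (nu' - nu) x01 (w := fun=> - K) (w' := U) (i := i).
have hr := policy_step_homo lambda_bound mu_bound beta_bound (fun=> 0)
  (nu' - nu) x01 (w := U) (w' := fun=> K) (i := i).
have /andP[c1 c2] := charge_bound (nu' - nu) x01.
have /andP[a1 a2] := UK i.+1; have /andP[a3 a4] := UK 1%N.
have actc a : policy_step (fun=> 0) (nu' - nu) x (fun=> a) i =
    beta * a + lambda * x * (nu' - nu).
  by rewrite /policy_step /net_charge; ring.
have := hl a1 a3; have := hr a2 a4; rewrite !actc => e1 e2.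
by rewrite ler_norml; apply/andP; split; lra.
Qed.

Lemma optimal_value_lipschitz nu nu' i :
  `|optimal_value nu' i - optimal_value nu i| <= slack (nu' - nu).
Proof.
have cv : `|iterate nu' n i - iterate nu n i| @[n --> \oo] -->
    `|optimal_value nu' i - optimal_value nu i|.
  by apply: cvg_norm; apply: cvgB; exact: iterate_cvg.
apply: (ler_cvg_to cv (cvg_cst _)).
by apply: nearW => n; exact: iterate_lipschitz.
Qed.

Lemma optimal_net_charge_increment nu nu' i : (0 < i)%N -> nu <= nu' ->
  (1 - beta) / (1 - beta * (1 - lambda * mu)) * (nu' - nu) <=
    optimal_net_charge nu' i - optimal_net_charge nu i <=
  (1 + beta * mu / (1 - beta)) * (nu' - nu).
Proof.
move=> i0 nn'; pose U j := optimal_value nu' j - optimal_value nu j.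
have d0 : 0 <= nu' - nu by rewrite subr_ge0.
(* The slopes are chosen age by age and serve as the coefficients in [sensitivity_bounds]. *)
pose x j := sval (cid2 (optimal_value_secant nu nu' j)).
have x01 j : (0 < j)%N -> 0 <= x j <= 1.
  by move=> _; rewrite /x; case: cid2.
have UE j : (0 < j)%N -> U j = policy_step (fun=> 0) (nu' - nu) (x j) U j.
  by move=> _; rewrite /x; case: cid2.
have UK j : (0 < j)%N -> `|U j| <= slack (nu' - nu).
  by move=> _; exact: optimal_value_lipschitz.
have := sensitivity_bounds lambda_bound mu_bound beta_bound d0 x01 UK UE i0.
have -> : net_charge (nu' - nu) U i =
    optimal_net_charge nu' i - optimal_net_charge nu i.
  by rewrite /optimal_net_charge /net_charge /U; ring.
by rewrite ger0_norm// => /andP[-> h] /=; lra.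
Qed.

Lemma optimal_net_charge_slope_gt0 :
  0 < (1 - beta) / (1 - beta * (1 - lambda * mu)).
Proof.
have /andP[l0 l1] := lambda_bound; have /andP[m0 m1] := mu_bound.
have /andP[b0 b1] := beta_bound.
have p0 : 0 < lambda * mu by rewrite mulr_gt0.
by apply: divr_gt0; [rewrite subr_gt0|nra].
Qed.

Lemma optimal_net_charge_lt nu nu' i : (0 < i)%N -> nu < nu' ->
  optimal_net_charge nu i < optimal_net_charge nu' i.
Proof.
move=> i0 nn'; have /andP[+ _] := optimal_net_charge_increment i0 (ltW nn').
rewrite -subr_gt0; apply: lt_le_trans.
by rewrite mulr_gt0 ?optimal_net_charge_slope_gt0// subr_gt0.
Qed.

Lemma critical_charge i : (0 < i)%N -> exists nu, optimal_net_charge nu i = 0.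
Proof.
move=> i0; apply: (increasing_has_root optimal_net_charge_slope_gt0) =>
  nu nu' nn'.
exact: optimal_net_charge_increment.
Qed.

Lemma critical_charge_le nustar nu i : (0 < i)%N ->
  optimal_net_charge nustar i = 0 ->
  (optimal_net_charge nu i <= 0) = (nu <= nustar).
Proof.
move=> i0 e; have [h|h|->] := ltgtP nu nustar.
- by rewrite -e ltW// optimal_net_charge_lt.
- by apply/negbTE; rewrite -ltNge -e optimal_net_charge_lt.
- by rewrite e lexx.
Qed.

Lemma critical_charge_ge nustar nu i : (0 < i)%N ->
  optimal_net_charge nustar i = 0 ->
  (0 <= optimal_net_charge nu i) = (nustar <= nu).
Proof.
move=> i0 e; have [h|h|->] := ltgtP nu nustar.
- by apply/negbTE; rewrite -ltNge -e optimal_net_charge_lt.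
- by rewrite -e ltW// optimal_net_charge_lt.
- by rewrite e lexx.
Qed.

End ValueIteration.

(** * Threshold policies and the MP index *)

(* [S i] is [\sum_n c (i + n) * q ^ n]: for [q > 0], the remainder of the given
   series divided by [q ^ i]. *)
Lemma supersolution (R : realType) (q : R) (c : nat -> R) : 0 <= q ->
  (forall i, (0 < i)%N -> 0 <= c i) ->
  (\sum_(1 <= i <oo) (c i * q ^+ i)%:E < +oo)%E ->
  exists2 S : nat -> R, (forall i, 0 <= S i) &
    forall i, positive_cost c i + q * S i.+1 <= S i.
Proof.
move=> q0 c0 fin.
have pc0 i : 0 <= positive_cost c i by apply: c0; rewrite leq_max.
(* The remainder formula divides by powers of [q]; for [q = 0] only its first term survives. *)
have [->|qn0] := eqVneq q 0.
  by exists (positive_cost c) => // i; rewrite mul0r addr0.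
have {}q0 : 0 < q by rewrite lt_neqAle eq_sym qn0.
have t0 i : (1 <= i)%N -> (0 <= (c i * q ^+ i)%:E)%E.
  by move=> i0; rewrite lee_fin mulr_ge0 ?c0// exprn_ge0// ltW.
set T := (\sum_(1 <= i <oo) _)%E in fin.
have T0 : (0 <= T)%E by apply: nneseries_ge0 => i i0 _; exact: t0.
pose p n := \sum_(1 <= i < n) c i * q ^+ i.
have pT n : p n <= fine T.
  rewrite -lee_fin fineK ?ge0_fin_numE// /p -sumEFin.
  by apply: nneseries_lim_ge => i i0 _; exact: t0.
pose S' n := (fine T - p n) / q ^+ n.
have S'0 n : 0 <= S' n by rewrite divr_ge0 ?subr_ge0// exprn_ge0// ltW.
have S'S n : (0 < n)%N -> c n + q * S' n.+1 = S' n.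
  move=> n0; rewrite /S' {1}/p big_nat_recr//= -/(p n) exprS.
  have qn : q ^+ n != 0 by rewrite expf_neq0.
  by field; rewrite qn0 qn.
(* The series has no term at age 0, so [S' 0] would be too small; the value there is set by the
   required inequality itself. *)
exists (fun n => if n is 0 then positive_cost c 0 + q * S' 1%N else S' n).
  by case=> // ; rewrite addr_ge0// mulr_ge0// ltW.
case=> // n; rewrite /positive_cost (maxn_idPr _)// S'S//.
Qed.

(** * Optimal rules are the greedy ones; thresholds, critical charges and the MP index *)

Section ThresholdIndexability.
Context {R : realType}.
Variables lambda mu beta : R.
Hypothesis lambda_bound : 0 < lambda <= 1.
Hypothesis mu_bound : 0 < mu <= 1.
Hypothesis beta_bound : 0 < beta < 1.
Variable M : chain_family lambda mu.
Variable c : nat -> R.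
Hypothesis c_ge0 : forall i, (0 < i)%N -> 0 <= c i.
Hypothesis c_le : forall i j, (0 < i)%N -> (i <= j)%N -> c i <= c j.
Variable S : nat -> R.
Hypothesis S_ge0 : forall i, 0 <= S i.
Hypothesis S_super :
  forall i, positive_cost c i + (1 - lambda * mu) * S i.+1 <= S i.

Local Notation k := (positive_cost c).
Local Notation value := (value lambda mu beta).
Local Notation V := (optimal_value lambda mu beta k).
Local Notation phi := (optimal_net_charge lambda mu beta k).
Local Notation net_charge := (net_charge mu beta).

Let k_ge0 i : 0 <= k i.
Proof. by apply: c_ge0; rewrite leq_max. Qed.

Let k_le i j : (i <= j)%N -> k i <= k j.
Proof.
move=> ij; apply: c_le; first by rewrite leq_max.
by rewrite geq_max leq_max /= leq_max ij orbT.
Qed.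

(** Allows the operator lemmas to be used with 1 in place of [lambda], that is, in states with a
    packet present. *)
Let one_bound : (0 : R) < 1 <= (1 : R).
Proof. by rewrite ltr01 lexx. Qed.

Lemma rule_bound (r : rule R) i : 0 <= (r i)%:num <= 1.
Proof. by apply/andP; split; [exact: ge0|exact: le1]. Qed.

Definition mean_value (h : nat -> R) (nu : R) (r : rule R) (n i : nat) : R :=
  flag_mean lambda (value (slot_cost h nu) n (stationary r)) i.

Lemma mean_value0 h nu r i : mean_value h nu r 0 i = 0.
Proof. by rewrite /mean_value /flag_mean /value /discounted !big_ord0;
  ring. Qed.

Lemma value_stationaryS h nu r n b i :
  value (slot_cost h nu) n.+1 (stationary r) (b, i) =
  policy_step b%:R mu beta h nu (r i)%:num (mean_value h nu r n) i.
Proof. by rewrite valueS /policy_step /net_charge /mean_value /=; case: b;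
  rewrite ?mul0r ?mul1r /=. Qed.

Lemma mean_valueS h nu r n i :
  mean_value h nu r n.+1 i = policy_step lambda mu beta h nu (r i)%:num
    (mean_value h nu r n) i.
Proof.
by rewrite {1}/mean_value /flag_mean !value_stationaryS /policy_step /=; ring.
Qed.

(** The optimal value of the state [y]: one Bellman step with the known flag in place of
    [lambda]. *)
Definition state_value (nu : R) (y : state) : R :=
  bellman y.1%:R mu beta k nu (V nu) y.2.

Lemma mean_state_value nu i :
  flag_mean lambda (state_value nu) i = V nu i.
Proof.
rewrite [RHS](optimal_valueE lambda_bound mu_bound beta_bound k_ge0 S_ge0
  S_super).
by rewrite /flag_mean /state_value /bellman /=; ring.
Qed.

(** The inequality holds at each finite horizon, against one Bellman step applied to [iterate]. The
    limit is taken in the extended reals, as the objective may be [+oo]. *)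
Lemma objective_ge nu r y : (0 < y.2)%N ->
  ((state_value nu y)%:E <= objective beta c M nu (stationary r) y)%E.
Proof.
case: y => b i /= i0.
have := @objective_cvg _ _ _ lambda_bound mu_bound _ beta_bound _ c_ge0 M nu
  (stationary r) (b, i) i0.
rewrite -cvg_shiftS => cv.
pose u n := bellman b%:R mu beta k nu (iterate lambda mu beta k nu n) i.
have uV : u n @[n --> \oo] --> state_value nu (b, i).
  by apply: bellman_cvg;
     apply: (iterate_cvg lambda_bound mu_bound beta_bound k_ge0 S_ge0 S_super).
have euV : (u n)%:E @[n --> \oo] --> (state_value nu (b, i))%:E.
  by apply: cvg_EFin => //; exact: nearW.
apply: (lee_cvg_to euV cv); apply: nearW => n.
rewrite lee_fin value_stationaryS.
have it j := iterate_le_policy lambda_bound mu_bound beta_bound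
  (rule_bound r) (mean_value0 k nu r) (mean_valueS k nu r) n j.
rewrite /u; case: b {cv uV euV u} => /=.
  apply: le_trans (bellman_le_policy_step mu beta one_bound k nu _ i
    (rule_bound r i)) _.
  exact: (policy_step_homo one_bound mu_bound beta_bound k nu (rule_bound r i)).
rewrite /bellman /policy_step !mul0r !addr0 lerD2l.
by rewrite ler_wpM2l//; case/andP: beta_bound => /ltW.
Qed.

(** Attempt surely where [phi] is negative, abstain where it is positive, and randomize freely where
    it vanishes. *)
Definition greedy (nu : R) (r : rule R) : Prop :=
  forall i, (0 < i)%N -> (r i)%:num * phi nu i = Num.min 0 (phi nu i).

Lemma greedy_mean_value_cvg nu r i : greedy nu r -> (0 < i)%N ->
  mean_value k nu r n i @[n --> \oo] --> V nu i.
Proof.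
move=> gr; exact: (greedy_cvg lambda_bound mu_bound beta_bound k_ge0 S_ge0
  S_super (rule_bound r) (mean_value0 k nu r) (mean_valueS k nu r) gr).
Qed.

Lemma greedy_objective nu r y : greedy nu r -> (0 < y.2)%N ->
  objective beta c M nu (stationary r) y = (state_value nu y)%:E.
Proof.
case: y => b i /= gr i0.
have := @objective_cvg _ _ _ lambda_bound mu_bound _ beta_bound _ c_ge0 M nu
  (stationary r) (b, i) i0.
rewrite -cvg_shiftS => cv.
rewrite -(cvg_lim _ cv)//; apply: cvg_lim => //.
apply: cvg_EFin; first exact: nearW.
rewrite /comp /=.
rewrite (_ : (fun n => _) = (fun n =>
  policy_step b%:R mu beta k nu (r i)%:num (mean_value k nu r n) i));
    last first.
  by apply/funext => n; rewrite value_stationaryS.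
rewrite (_ : state_value nu (b, i) =
  policy_step b%:R mu beta k nu (r i)%:num (V nu) i); last first.
  rewrite /state_value /bellman /policy_step -mulrA.
  by rewrite -[net_charge _ _ _]/(phi nu i) gr.
by apply: policy_step_cvg; apply: greedy_mean_value_cvg.
Qed.

Lemma greedy_optimal nu r : greedy nu r -> optimal beta c M nu r.
Proof. by move=> gr y y0 r'; rewrite greedy_objective// objective_ge. Qed.

Lemma pureE (a : bool) : (pure R a)%:num = a%:R.
Proof. by case: a. Qed.

Definition greedy_rule (nu : R) : rule R := fun i => pure R (phi nu i < 0).

Lemma greedy_ruleP nu : greedy nu (greedy_rule nu).
Proof.
move=> i _; rewrite /greedy_rule pureE.
by have [_|_|->] := ltgtP (phi nu i) 0; rewrite ?mul1r ?mul0r.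
Qed.

(** An optimal rule attains [state_value] from every initial state, so its own one-step recursion
    passes to the limit with [V] on the right; comparison with the Bellman equation in state
    [(true, j)] leaves the greedy identity. *)
Lemma optimal_greedy nu r : optimal beta c M nu r -> greedy nu r.
Proof.
move=> opt.
have objE y : (0 < y.2)%N ->
    objective beta c M nu (stationary r) y = (state_value nu y)%:E.
  move=> y0; apply/eqP; rewrite eq_le objective_ge// andbT.
  by rewrite -(greedy_objective (@greedy_ruleP nu) y0) opt.
have cv y : (0 < y.2)%N ->
    value (slot_cost k nu) n (stationary r) y @[n --> \oo] --> state_value nu y.
  move=> y0; have := @objective_cvg _ _ _ lambda_bound mu_bound _ beta_bound _
    c_ge0 M nu (stationary r) y y0.
  by rewrite objE// => /fine_cvgP[_].
have mv i : (0 < i)%N -> mean_value k nu r n i @[n --> \oo] --> V nu i.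
  move=> i0; rewrite -mean_state_value.
  by apply: cvgD; apply: cvgM; [exact: cvg_cst|exact: cv|
    exact: cvg_cst|exact: cv].
move=> j j0.
have := cv (true, j) j0; rewrite -cvg_shiftS => c1.
have c2 : value (slot_cost k nu) n.+1 (stationary r) (true, j) @[n --> \oo] -->
    policy_step 1 mu beta k nu (r j)%:num (V nu) j.
  rewrite (_ : (fun n => _) = (fun n =>
    policy_step 1 mu beta k nu (r j)%:num (mean_value k nu r n) j)); last first.
    by apply/funext => n; rewrite value_stationaryS.
  by apply: policy_step_cvg; exact: mv.
have : policy_step 1 mu beta k nu (r j)%:num (V nu) j =
    state_value nu (true, j).
  by rewrite -(cvg_lim _ c1)//; apply/esym/cvg_lim.
by rewrite /state_value /bellman /policy_step /= !mul1r => /addrI.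
Qed.

Lemma optimal_actionP nu j a : (0 < j)%N ->
  optimal_action beta c M nu j a <->
  (if a then phi nu j <= 0 else 0 <= phi nu j).
Proof.
move=> j0; split.
  move=> [r /optimal_greedy gr rj]; have := gr j j0; rewrite rj pureE.
  by case: a {rj}; rewrite ?mul1r ?mul0r; case: (ltP 0 (phi nu j)); lra.
(* Greediness is a condition on each age separately, so the action may be changed at [j] alone. *)
move=> h; exists (fun i => if i == j then pure R a else greedy_rule nu i).
  apply: greedy_optimal => i i0; case: eqP => [->|_]; last exact: greedy_ruleP.
  rewrite pureE; case: a h => h; rewrite ?mul1r ?mul0r.
    by rewrite min_r.
  by rewrite min_l.
by rewrite eqxx.
Qed.

Lemma threshold_greedy nu t : (forall i, (0 < i)%N ->
    if (if t is Some m then (m < i)%N else false) then phi nu i <= 0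
    else 0 <= phi nu i) ->
  greedy nu (threshold R t).
Proof.
move=> h i i0; rewrite /threshold pureE; have := h i i0.
by case: ifP => _ hi; rewrite ?mul1r ?mul0r; [rewrite min_r|rewrite min_l].
Qed.

Lemma threshold_optimal nu : exists t, optimal beta c M nu (threshold R t).
Proof.
have ge_age := optimal_net_charge_ge_age lambda_bound mu_bound beta_bound k_ge0
  k_le S_ge0 S_super nu.
have [[i0 /andP[]]|none] := pselect (exists i, (0 < i)%N && (phi nu i <= 0)).
  move=> i0_gt0 hi0.
  have ex : exists i, (0 < i)%N && (phi nu i <= 0) by exists i0; rewrite i0_gt0.
  case: (ex_minnP ex) => m /andP[m0 hm] min_m.
  (* [m] is the first age with [phi <= 0]; a [k]-policy attempts strictly above [k], hence the
     predecessor. *)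
  exists (Some m.-1); apply/greedy_optimal/threshold_greedy => i i_gt0.
  rewrite prednK//; case: ifPn => mi; first exact: le_trans (ge_age _ _ mi) hm.
  rewrite leNgt; apply/negP => hi; move/negP: mi; apply; apply: min_m.
  by rewrite i_gt0 ltW.
exists None; apply/greedy_optimal/threshold_greedy => i i_gt0.
rewrite leNgt; apply/negP => hi; apply: none; exists i.
by rewrite i_gt0 ltW.
Qed.

Lemma critical_charge_mp_index nu j : (0 < j)%N -> phi nu j = 0 ->
  mp_index beta c M j = nu%:E.
Proof.
move=> j0 gap0; have /andP[b0 b1] := beta_bound.
pose r := threshold R (Some j).
have ge_age := optimal_net_charge_ge_age lambda_bound mu_bound beta_bound k_ge0
  k_le S_ge0 S_super nu.
(* The [j]-policy abstains at [j] itself, which is greedy because [phi] vanishes there. *)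
have gr : greedy nu r.
  apply: threshold_greedy => i _; case: ltnP => ij.
    by rewrite -gap0 ge_age// ltnW.
  by rewrite -gap0 ge_age.
pose G i := limn (fun n => mean_value (fun=> 0) 1 r n i).
have G_cvg i : mean_value (fun=> 0) 1 r n i @[n --> \oo] --> G i.
  have wc y : cvgn (fun n => value (slot_cost (fun=> 0) 1) n (stationary r) y).
    exact: work_cvg.
  by apply: is_cvgD; apply: is_cvgM => //; exact: is_cvg_cst.
(* The cost part of the optimal value: the [j]-policy attains [V] and its work is finite, so its
   cost is recovered by subtraction. *)
pose F i := V nu i - nu * G i.
have F_cvg i : (0 < i)%N -> mean_value k 0 r n i @[n --> \oo] --> F i.
  move=> i0; rewrite (_ : (fun n => _) = (fun n =>
    mean_value k nu r n i - nu * mean_value (fun=> 0) 1 r n i)).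
    apply: cvgB; first exact: greedy_mean_value_cvg.
    by apply: cvgM; [exact: cvg_cst|exact: G_cvg].
  apply/funext => n; rewrite /mean_value /flag_mean.
  by rewrite !(valueD _ _ _ k nu); ring.
(* The policy [<a, j>] is one step with [a] from a state with a packet, followed by the stationary
   rule [r]. *)
have dev_cvg h nu' (H : nat -> R) a :
    (forall i, (0 < i)%N -> mean_value h nu' r n i @[n --> \oo] --> H i) ->
    value (slot_cost h nu') n (deviation R a j) (true, j) @[n --> \oo] -->
    policy_step 1 mu beta h nu' a%:R H j.
  move=> HH; rewrite -cvg_shiftS.
  rewrite (_ : [sequence _]_n = (fun n =>
    policy_step 1 mu beta h nu' a%:R (mean_value h nu' r n) j)).
    by apply: policy_step_cvg; exact: HH.
  by apply/funext => n; rewrite /= valueS pureE /policy_step /net_charge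
    /mean_value mul1r.
have costE a : cost_metric beta c M (deviation R a j) (true, j) =
    (policy_step 1 mu beta k 0 a%:R F j)%:E.
  have cv := @cost_metric_cvg _ _ _ lambda_bound mu_bound _ beta_bound _ c_ge0 M
    (deviation R a j) (true, j) j0.
  rewrite -(cvg_lim _ cv)//; apply: cvg_lim => //.
  by apply: cvg_EFin; [exact: nearW|exact: dev_cvg].
have workE a : work_metric beta M (deviation R a j) (true, j) =
    (policy_step 1 mu beta (fun=> 0) 1 a%:R G j)%:E.
  rewrite work_metric_lim//; congr (_%:E); apply: cvg_lim => //.
  by apply: dev_cvg => i _; exact: G_cvg.
have G_bound i : `|G i| <= (1 - beta)^-1.
  have gi n : 0 <= mean_value (fun=> 0) 1 r n i <= (1 - beta)^-1.
    have vb y : 0 <= value (slot_cost (fun=> 0) 1) n (stationary r) y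
        <= (1 - beta)^-1.
      have wb t := work_bound lambda_bound mu_bound t (stationary r) y.
      rewrite discounted_le ?andbT//; last by move=> t; case/andP: (wb t).
      by apply: sumr_ge0 => t _; rewrite mulr_ge0 ?exprn_ge0 ?(ltW b0)//;
        case/andP: (wb t).
    have /andP[v1 v2] := vb (true, i); have /andP[v3 v4] := vb (false, i).
    have /andP[l0 l1] := lambda_bound.
    by rewrite /mean_value /flag_mean; apply/andP; split; nra.
  have h1 : 0 <= G i.
    by apply: (ler_cvg_to (cvg_cst _) (G_cvg i)); apply: nearW => n;
      case/andP: (gi n).
  rewrite ger0_norm//.
  by apply: (ler_cvg_to (G_cvg i) (cvg_cst _)); apply: nearW => n;
    case/andP: (gi n).
have G_act i : G i = policy_step lambda mu beta (fun=> 0) 1 (r i)%:num G i.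
  have := G_cvg i; rewrite -cvg_shiftS => c1.
  rewrite -(cvg_lim (@norm_hausdorff _ _) c1); apply: cvg_lim => //.
  rewrite (_ : [sequence _]_n = (fun n =>
    policy_step lambda mu beta (fun=> 0) 1 (r i)%:num
      (mean_value (fun=> 0) 1 r n) i)).
    by apply: policy_step_cvg; exact: G_cvg.
  by apply/funext => n; rewrite /= mean_valueS.
have /andP[gapG _] := @sensitivity_bounds _ _ _ _ lambda_bound mu_bound
  beta_bound G (fun i => (r i)%:num) 1 _ ler01 (fun i _ => rule_bound r i)
  (fun i _ => G_bound i) (fun i _ => G_act i) j j0.
(* This is the marginal work: an attempt now, less the discounted change in later work. *)
have gapG0 : 0 < net_charge 1 G j.
  apply: lt_le_trans gapG; rewrite mulr1.
  exact: (optimal_net_charge_slope_gt0 lambda_bound mu_bound beta_bound).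
rewrite /mp_index /marginal_cost /marginal_work !costE !workE -!EFinB.
(* The marginal cost is [beta * mu * (F j.+1 - F 1)], and [phi nu j = 0] says that
   [beta * mu * (V nu j.+1 - V nu 1) = nu]. *)
rewrite (_ : _ - _ = nu * net_charge 1 G j); last first.
  move: gap0; rewrite /optimal_net_charge /policy_step /net_charge /F /=; lra.
rewrite (_ : _ - _ = net_charge 1 G j); last first.
  by rewrite /policy_step /=; ring.
by rewrite inver gt_eqF// -EFinM mulfK// gt_eqF.
Qed.

Lemma threshold_indexable_mp_index :
  threshold_indexable beta c M /\
  forall nustar : nat -> R, is_whittle_index beta c M nustar ->
    forall i : nat, (0 < i)%N -> (nustar i)%:E = mp_index beta c M i.
Proof.
split; [split; [|exact: threshold_optimal]|].
- have /choice[nustar nuE] : forall i, exists nu, (0 < i)%N -> phi nu i = 0.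
    move=> i; have [i0|] := ltnP 0 i; last by exists 0.
    have [nu e] := critical_charge lambda_bound mu_bound beta_bound k_ge0 S_ge0
      S_super i0.
    by exists nu.
  exists nustar => j j0 nu; rewrite !optimal_actionP//.
  rewrite (critical_charge_le lambda_bound mu_bound beta_bound k_ge0 S_ge0
    S_super _ j0 (nuE j j0)).
  by rewrite (critical_charge_ge lambda_bound mu_bound beta_bound k_ge0 S_ge0
    S_super _ j0 (nuE j j0)).
- move=> nustar Wnu i i0; apply/esym/critical_charge_mp_index => //.
  (* At the charge equal to the index both actions are optimal, so [phi] is both nonpositive and
     nonnegative there. *)
  have [[_ h1] [_ h2]] := Wnu i i0 (nustar i).
  have /(optimal_actionP _ _ i0) g1 := h1 (lexx _).
  have /(optimal_actionP _ _ i0) g2 := h2 (lexx _).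
  by apply/eqP; rewrite eq_le g1 g2.
Qed.

End ThresholdIndexability.

Theorem proposition3 (R : realType) (lambda mu beta : R)
    (hlambda : 0 < lambda <= 1) (hmu : 0 < mu <= 1) (hbeta : 0 < beta < 1)
    (M : chain_family lambda mu)
    (c : nat -> R)
    (c_ge0 : forall i : nat, (0 < i)%N -> 0 <= c i)
    (c_nondecreasing : forall i j : nat, (0 < i)%N -> (i <= j)%N -> c i <= c j)
    (c_summable :
       (\sum_(1 <= i <oo) (c i * (1 - lambda * mu) ^+ i)%:E < +oo)%E) :
  threshold_indexable beta c M /\
  forall nustar : nat -> R, is_whittle_index beta c M nustar ->
    forall i : nat, (0 < i)%N -> (nustar i)%:E = mp_index beta c M i.
Proof.
have q0 : 0 <= 1 - lambda * mu.
  have /andP[l0 l1] := hlambda; have /andP[m0 m1] := hmu.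
  by rewrite subr_ge0 mulr_ile1// ltW.
have [S S0 SS] := supersolution q0 c_ge0 c_summable.
exact: (threshold_indexable_mp_index hlambda hmu hbeta M c_ge0 c_nondecreasing
  S0 SS).
Qed.
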